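(* Let $(X,\tau)$ be a non-trivial real Hausdorff locally convex space with topological dual $X^*$. The following are equivalent: (i) For every $f\in\Gamma_\tau(X)$, $\partial f$ is maximal monotone. (ii) For every $f\in\Gamma_\tau(X)$, $x\in\operatorname{dom}f$, $x^*\in X^*$, $\varphi_{\partial f}(x,x^* )\ge\langle x,x^*\rangle$. (iii) For every $f\in\Gamma_\tau(X)$, $x\in\operatorname{dom}f$, $f(x)=f^{\smile}(x)$. (iv) For every $f\in\Gamma_\tau(X)$, $f=f^{\smile}$. (v) For every $f\in\Gamma_\tau(X)$, $x\in\operatorname{dom}f$ there is a net $\{(a_i,a_i^* )\}_{i\in I}\subset\operatorname{Graph}(\partial f)$ such that $a_i\to x$ in $(X,\tau)$, $f(a_i)\to f(x)$, and $\langle x-a_i,a_i^*\rangle+f(a_i)\to f(x)$. (vi) For every $f\in\Gamma_\tau(X)$, $x\in\operatorname{dom}f$ there is a net $\{(a_i,a_i^* )\}_{i\in I}\subset\operatorname{Graph}(\partial f)$ such that $\langle x-a_i,a_i^*\rangle\to0$. (vii) For every $f\in\Gamma_\tau(X)$, $x\in\operatorname{dom}f$, $\epsilon>0$ there is $(a_\epsilon,a_\epsilon^* )\in\operatorname{Graph}(\partial f)$ such that $\langle x-a_\epsilon,a_\epsilon^*\rangle\ge-\epsilon$. In this case (that is, when these equivalent conditions hold), for every $f\in\Gamma_\tau(X)$ one has $\overline{D(\partial f)}^{\tau}=\operatorname{cl}_\tau(\operatorname{dom}f)$ and $\overline{R(\partial f)}^{w^*}=\operatorname{cl}_{w^*}(\operatorname{dom}f^*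 )$, and these sets are convex.
   Context: $X^*$ is endowed with the weak-star topology $w^*$, and $\langle x,x^*\rangle:=x^*(x)$. Conventions: $\overline{\mathbb R}=[-\infty,\infty]$, $\infty-\infty=\infty$, $\sup\emptyset=-\infty$, $\inf\emptyset=\infty$. For $f:X\to\overline{\mathbb R}$: $\operatorname{dom}f=\{x\in X\mid f(x)<\infty\}$; $f$ is proper if $\operatorname{dom}f\ne\emptyset$ and $f$ never takes the value $-\infty$. $\Gamma_\tau(X)$ is the class of proper convex $\tau$-lower semicontinuous functions $f:X\to\overline{\mathbb R}$. The conjugate is $f^*(x^* )=\sup_{x\in X}\{\langle x,x^*\rangle-f(x)\}$, $x^*\in X^*$. The subdifferential $\partial f:X\rightrightarrows X^*$: $x^*\in\partial f(x)$ iff $f(x)$ is finite and $f(y)\ge f(x)+\langle y-x,x^*\rangle$ for every $y\in X$. For $T:X\rightrightarrows X^*$, $\operatorname{Graph}T=\{(x,x^* )\mid x^*\in T(x)\}$, and $D(T)$, $R(T)$ are the projections of $\operatorname{Graph}T$ onto $X$, $X^*$. $T$ is monotone if $\langle x_1-x_2,x_1^*-x_2^*\rangle\ge0$ for all $(x_1,x_1^* ),(x_2,x_2^* )\in\operatorname{Graph}T$; it is maximal monotone if it is nonempty, monotone and maximal (with respect to graph inclusion in $X\times X^*$) among monotone operators. Fitzpatrick function: $\varphi_T(x,x^* ):=\sup\{\langle x-a,a^*\rangle+\langle a,x^*\rangle\mid(a,a^* )\in\operatorname{Graph}T\}$. Low-upper envelope: $f^{\smile}(x):=\sup\{\langle x-a,a^*\rangle+f(a)\mid(a,a^*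 )\in\operatorname{Graph}(\partial f),\ f(a)\le f(x)\}$, $x\in X$. *)

(* Defs.v *)
From HB Require Import structures.
From mathcomp Require Import all_boot all_order all_algebra.
From mathcomp Require Import all_classical all_reals all_analysis.

Set Implicit Arguments.
Unset Strict Implicit.
Unset Printing Implicit Defensive.

Import Order.TTheory GRing.Theory Num.Theory.
Import numFieldNormedType.Exports.

Local Open Scope classical_set_scope.
Local Open Scope ring_scope.

Section topological_dual.
Context (R : realType) (X : tvsType R).

Definition cont_linear : {pred X -> R^o} :=
  [pred f : X -> R^o | `[< linear f /\ continuous f >]].

Lemma cont_linear_submod_closed : submod_closed cont_linear.
Proof.
split.
  apply/asboolP; split=> [a x y|x]; last exact: cvg_cst.
  by rewrite /= scaler0 addr0.
move=> a f g /asboolP[lf cf] /asboolP[lg cg]; apply/asboolP; split.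
  move=> b x y; rewrite !fctE lf lg !scalerDr addrACA; congr (_ + _).
  by congr (_ + _); rewrite !scalerA mulrC.
move=> x; apply: cvgD; last exact: cg.
by apply: cvgZl_tmp; exact: cf.
Qed.

HB.instance Definition _ :=
  GRing.isSubmodClosed.Build R (X -> R^o) cont_linear cont_linear_submod_closed.

Record dual := Dual {
  dual_fun : X -> R^o ;
  _ : dual_fun \in cont_linear }.

HB.instance Definition _ := [isSub for dual_fun].
HB.instance Definition _ := [Choice of dual by <:].
HB.instance Definition _ := [SubChoice_isSubLmodule of dual by <:].

(* The weak-star topology is the topology of pointwise convergence on X. *)
HB.instance Definition _ := Topological.copy dual
  (initial_topology (dual_fun : dual -> {ptws X -> R^o})).

Definition pairing (x : X) (xs : dual) : R := dual_fun xs x.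

Fact dual_fun_linear xs : linear (dual_fun xs).
Proof. by case: xs => f /= /asboolP[]. Qed.

HB.instance Definition _ xs :=
  GRing.isLinear.Build R X R^o *:%R (dual_fun xs) (dual_fun_linear xs).

Fact dual_fun_continuous xs : continuous (dual_fun xs).
Proof. by case: xs => f /= /asboolP[]. Qed.

End topological_dual.

Section extended_real_functions.
Local Open Scope ereal_scope.
Context (R : realType).

Definition edom (T : Type) (f : T -> \bar R) : set T := [set x | f x < +oo].

Definition proper (T : Type) (f : T -> \bar R) : Prop :=
  edom f !=set0 /\ forall x, f x != -oo.

(* Only used for proper f: the right-hand side then never meets +oo + -oo,
   which the library evaluates to -oo. *)
Definition econvex (E : lmodType R) (f : E -> \bar R) : Prop :=
  forall (x y : E) (t : R), (0 < t < 1)%R ->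
    f (t *: x + (1 - t) *: y)%R <= t%:E * f x + (1 - t)%:E * f y.

End extended_real_functions.

Section subdifferentials.
Local Open Scope ereal_scope.
Context (R : realType) (X : tvsType R).
Implicit Types (f : X -> \bar R) (T : X -> set (dual X)).

Definition Gamma f : Prop :=
  [/\ proper f, econvex f & lower_semicontinuous f].

Definition conjugate f (xs : dual X) : \bar R :=
  ereal_sup [set (pairing x xs)%:E - f x | x in [set: X]].

Definition subdiff f (x : X) : set (dual X) :=
  [set xs | f x \is a fin_num /\
    forall y, f x + (pairing (y - x)%R xs)%:E <= f y].

Definition Graph T : set (X * dual X) := [set p | T p.1 p.2].

Definition Dom T : set X := [set p.1 | p in Graph T].

Definition Ran T : set (dual X) := [set p.2 | p in Graph T].

Definition monotone T : Prop := forall p q, Graph T p -> Graph T q ->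
  (0 <= pairing (p.1 - q.1) (p.2 - q.2))%R.

Definition maximal_monotone T : Prop :=
  [/\ Graph T !=set0, monotone T &
      forall S : X -> set (dual X),
        monotone S -> Graph T `<=` Graph S -> Graph S = Graph T].

Definition fitzpatrick T (x : X) (xs : dual X) : \bar R :=
  ereal_sup [set (pairing (x - a.1)%R a.2 + pairing a.1 xs)%:E | a in Graph T].

Definition low_upper f (x : X) : \bar R :=
  ereal_sup [set (pairing (x - a.1)%R a.2)%:E + f a.1 |
             a in Graph (subdiff f) `&` [set a | f a.1 <= f x]].

End subdifferentials.

Record directed_set := DirectedSet {
  directed_sort :> Type ;
  directed_le : directed_sort -> directed_sort -> Prop ;
  directed_inhabited : exists i : directed_sort, True ;
  directed_refl : forall i, directed_le i i ;
  directed_trans : forall i j k,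
    directed_le i j -> directed_le j k -> directed_le i k ;
  directed_ub : forall i j, exists2 k, directed_le i k & directed_le j k }.

(* A net u : I -> Y converges to y iff u @ tails I --> y. *)
Definition tails (I : directed_set) : set_system I :=
  [set P | exists i, forall j, directed_le i j -> P j].
Arguments tails : clear implicits.

Global Instance tails_proper_filter (I : directed_set) : ProperFilter (tails I).
Proof.
split; first by move=> [i /(_ i (directed_refl i))].
split.
- by have [i _] := directed_inhabited I; exists i.
- move=> P Q [i iP] [j jQ]; have [k ik jk] := directed_ub i j.
  exists k => l kl; split; first exact/iP/(directed_trans ik).
  exact/jQ/(directed_trans jk).
- by move=> P Q PQ [i iP]; exists i => j /iP/PQ.
Qed.

(* Main.v *)
Require Import Defs.
From HB Require Import structures.
From mathcomp Require Import all_boot all_order all_algebra.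
From mathcomp Require Import all_classical all_reals all_analysis.
From mathcomp Require Import ring lra.

(** Everything is deduced from (vii), by applying it not to f but to two kinds
    of auxiliary functions of Gamma.
    - f + p(. - x), with p a continuous sublinear function.  By the
      Hahn-Banach theorem a subgradient of the sum splits as (subgradient of f)
      + (subgradient of p), and the second part contributes p(a - x) to
      <x - a, a*>, which forces a to be close to x.
    - g(y) = min_{|t| <= 1} f(y - t v) + N |t|.  A subgradient y* of g at y is
      a subgradient of f at y - t v for the minimizing t, and it satisfies
      t y*(v) >= N |t| and t y*(v) - N |t| >= |y*(v)| - N.  With v = x - u and
      u in dom f, the point x lies in dom g although f(x) may be infinite: this
      yields (iv) outside dom f (N large) and maximality (N small).  With N = 0
      and v running through finitely many vectors, it makes y*(v) small, which
      is the weak-star density of R(subdiff f) in dom f*. *)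

Set Implicit Arguments.
Unset Strict Implicit.
Unset Printing Implicit Defensive.

Import Order.TTheory GRing.Theory Num.Theory.
Import numFieldNormedType.Exports.

Local Open Scope classical_set_scope.
Local Open Scope ring_scope.

(** * A Hahn-Banach theorem for convex functions *)

Section hahn_banach.
Context (R : realType) (V : lmodType R).
Implicit Types (g q : V -> R) (S : V -> set R).

Definition rconvex g := forall (x y : V) (t : R), 0 < t < 1 ->
  g (t *: x + (1 - t) *: y) <= t * g x + (1 - t) * g y.

(** Elements of [S x] and [S y] within [e] of their infima combine to one that exceeds the combined
    infima by at most [e]. This covers infima along chains, along directions and in convolutions. *)
Lemma rconvex_inf S : (forall x, has_inf (S x)) ->
  (forall x y t a b, 0 < t < 1 -> S x a -> S y b ->
    exists2 c, S (t *: x + (1 - t) *: y) c & c <= t * a + (1 - t) * b) ->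
  rconvex (fun x => inf (S x)).
Proof.
move=> infS convS x y t t01; apply/ler_addgt0Pr => e e0.
have [a Sxa ae] := inf_adherent e0 (infS x).
have [b Syb be] := inf_adherent e0 (infS y).
have [c Sc cab] := convS _ _ _ _ _ t01 Sxa Syb.
apply: (le_trans (ge_inf (infS _).2 Sc)); apply: (le_trans cab).
by case/andP: t01 => t0 t1; nra.
Qed.

Lemma rconvex_mid g x y : rconvex g -> 2 * g (2^-1 *: (x + y)) <= g x + g y.
Proof.
move=> cg; have h : 0 < (2^-1 : R) < 1 by lra.
have := cg x y _ h; have -> : 1 - 2^-1 = 2^-1 :> R by field.
by rewrite -scalerDr; lra.
Qed.

Definition convex_minorant q g := [/\ rconvex g, 0 <= g 0 & forall x, g x <= q x].

(** Midpoint convexity at [x] and [- x], together with [0 <= g 0]. The bound depends on [q] alone,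
    so pointwise infima of minorants stay finite. *)
Lemma convex_minorant_ge q g x : convex_minorant q g -> - q (- x) <= g x.
Proof.
move=> [cg g0 gq]; have := rconvex_mid x (- x) cg.
by rewrite subrr scaler0; have := gq (- x); lra.
Qed.

(** Zorn's lemma, with [Rel] reversing the pointwise order so that its maximal elements are minimal
    minorants. A chain is bounded by its pointwise infimum. *)
Lemma minimal_convex_minorant q : rconvex q -> 0 <= q 0 ->
  exists2 g, convex_minorant q g &
    forall h, convex_minorant q h -> (forall x, h x <= g x) -> h = g.
Proof.
move=> cq q0; pose T := {g | convex_minorant q g}.
pose Rel (g h : T) := `[< forall x, sval h x <= sval g x >].
have sval_inj (g h : T) : sval g = sval h -> g = h.
  case: g h => [g Kg] [h Kh] /= gh; move: Kg Kh; rewrite gh => Kg Kh.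
  by congr exist; exact: Prop_irrelevance.
have [||||[g Kg] gmin] := @Zorn T Rel.
- by move=> g; apply/asboolP.
- move=> r s t /asboolP rs /asboolP st; apply/asboolP => x.
  exact: le_trans (st x) (rs x).
- move=> s t /asboolP st /asboolP ts; apply/sval_inj/funext => x.
  by apply/eqP; rewrite eq_le st ts.
- move=> A Atot; have [->|/set0P[g0 Ag0]] := eqVneq A set0.
    have Kq : convex_minorant q q by [].
    by exists (exist _ q Kq).
  pose S x := [set sval g x | g in A].
  have infS x : has_inf (S x).
    split; first by exists (sval g0 x), g0.
    by exists (- q (- x)) => _ [g _ <-]; exact: convex_minorant_ge (svalP g).
  have Sg (g : T) x : A g -> inf (S x) <= sval g x.
    by move=> Ag; apply: (ge_inf (infS x).2); exists g.
  have KI : convex_minorant q (fun x => inf (S x)).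
    split.
    - apply: rconvex_inf => // x y t _ _ t01 [g Ag <-] [h Ah <-].
      have [t0 t1] := andP t01.
      (* In a chain, the smaller of [g] and [h] serves at both points. *)
      have [/asboolP gh|/asboolP gh] := Atot _ _ Ag Ah.
        exists (sval h (t *: x + (1 - t) *: y)); first by exists h.
        have [ch _ _] := svalP h; apply: (le_trans (ch _ _ _ t01)).
        by have := gh x; nra.
      exists (sval g (t *: x + (1 - t) *: y)); first by exists g.
      have [cg _ _] := svalP g; apply: (le_trans (cg _ _ _ t01)).
      by have := gh y; nra.
    - by apply: lb_le_inf; [exact: (infS 0).1|move=> _ [g _ <-]; have [] := svalP g].
    - move=> x; apply: (le_trans (Sg _ x Ag0)).
      by have [_ _] := svalP g0; exact.
  by exists (exist _ _ KI) => g Ag; apply/asboolP => x /=; exact: Sg.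
exists g => // h Kh hg.
have /(congr1 sval) : exist _ h Kh = exist _ g Kg :> T by apply: gmin; apply/asboolP.
by [].
Qed.

(** A minimal convex minorant is affine along every line and vanishes at 0, hence is linear. *)
Theorem hahn_banach_convex q : rconvex q -> 0 <= q 0 ->
  exists2 l : V -> R^o, linear l & forall x, l x <= q x.
Proof.
move=> cq q0; have [g Kg gmin] := minimal_convex_minorant cq q0.
have [cg g0 gq] := Kg.
have trans v : exists c, forall w s, g (w + s *: v) = g w + s * c.
  (* Since 0 is a convex combination of [s *: v] and [- r *: v], and [0 <= g 0], backward slopes
     never exceed forward ones. The infimum [c] of the forward slopes lies between the two. *)
  have slope (r s : R) : 0 < r -> 0 < s -> - (g (- r *: v) / r) <= g (s *: v) / s.
    move=> r0 s0; have rs0 : 0 < r + s by lra.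
    pose t := r / (r + s).
    have t01 : 0 < t < 1 by rewrite /t divr_gt0//= ltr_pdivrMr// mul1r; lra.
    have := cg (s *: v) (- r *: v) t t01.
    rewrite !scalerA -scalerDl.
    have -> : t * s + (1 - t) * - r = 0 by rewrite /t; field; lra.
    have -> : 1 - t = s / (r + s) by rewrite /t; field; lra.
    rewrite scale0r /t => le_g.
    have {}le_g : 0 <= r * g (s *: v) + s * g (- r *: v).
      have := le_trans g0 le_g.
      rewrite mulrAC [X in _ + X]mulrAC -mulrDl pmulr_lge0//.
      by rewrite invr_gt0.
    rewrite -subr_ge0 opprK.
    have -> : g (s *: v) / s + g (- r *: v) / r =
        (r * g (s *: v) + s * g (- r *: v)) / (r * s) by field; lra.
    by rewrite divr_ge0// mulr_ge0// ltW.
  pose C := [set g (s *: v) / s | s in [set s : R | 0 < s]].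
  have infC : has_inf C.
    split; first by exists (g (1 *: v) / 1), 1 => //=.
    exists (- (g (- 1 *: v) / 1)) => _ [s s0 <-]; exact: slope.
  pose c := inf C.
  have cge t : t * c <= g (t *: v).
    have [t0|t0|->] := ltgtP t 0.
    - have := lb_le_inf infC.1 (x := - (g (- - t *: v) / - t)).
      rewrite opprK => h.
      have {h} : - (g (t *: v) / - t) <= c.
        apply: h => _ [s s0 <-]; have := @slope (- t) s.
        by rewrite opprK; apply => //; lra.
      rewrite invrN mulrN opprK => h.
      have : g (t *: v) / t * (- t) <= c * (- t) by apply: ler_wpM2r => //; lra.
      rewrite mulrN divfK ?lt_eqF//; lra.
    - have : c <= g (t *: v) / t by apply: (ge_inf infC.2); exists t.
      by rewrite ler_pdivlMr// mulrC.
    - by rewrite mul0r scale0r.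
  (* The infimum over t of g(w + t v) - t c is a convex minorant of g, hence g
     itself by minimality: g is affine in the direction v with slope c. *)
  pose S w := [set g (w + t *: v) - t * c | t in [set: R]].
  have infS w : has_inf (S w).
    split; first by exists (g (w + 0 *: v) - 0 * c), 0.
    exists (- g (- w)) => _ [t _ <-].
    have := rconvex_mid (w + t *: v) (- w) cg.
    have := cge (2^-1 * t); rewrite -scalerA addrAC subrr add0r.
    by lra.
  have Sle w t : inf (S w) <= g (w + t *: v) - t * c.
    by apply: (ge_inf (infS w).2); exists t.
  have Sg w : inf (S w) <= g w by have := Sle w 0; rewrite mul0r scale0r addr0 subr0.
  have eqg : (fun w => inf (S w)) = g.
    apply: gmin => //; split.
    - apply: rconvex_inf => // x y t _ _ t01 [r _ <-] [s _ <-].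
      exists (g (t *: x + (1 - t) *: y + (t * r + (1 - t) * s) *: v)
              - (t * r + (1 - t) * s) * c).
        by exists (t * r + (1 - t) * s).
      have := cg (x + r *: v) (y + s *: v) t t01.
      rewrite !scalerDr addrACA !scalerA -scalerDl; lra.
    - apply: lb_le_inf; first exact: (infS 0).1.
      by move=> _ [t _ <-]; rewrite add0r subr_ge0.
    - by move=> x; apply: (le_trans (Sg x)).
  have step w t : g w <= g (w + t *: v) - t * c by rewrite -{1}eqg.
  exists c => w s; apply/eqP; rewrite eq_le; apply/andP; split.
    by have := step (w + s *: v) (- s); rewrite scaleNr addrK; lra.
  by have := step w s; lra.
(* Lowering [g] by the constant [g 0 >= 0] gives another convex minorant, so minimality forces
   [g 0 = 0]. *)
have g00 : g 0 = 0.
  have [c gc] := trans 0.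
  apply/eqP; rewrite eq_le g0 andbT.
  have hmin : (fun w => g w - g 0) = g.
    apply: gmin => [|x]; last by rewrite gerBl.
    split; [|by rewrite subrr|by move=> x; apply: le_trans (gq x); rewrite gerBl].
    by move=> x y t t01; have := cg x y t t01; lra.
  by have /(congr1 (fun h => h 0)) := hmin; rewrite subrr => <-.
exists g => // a x y; have [c gc] := trans x.
rewrite [a *: x + y]addrC gc [RHS]addrC.
by have := gc 0 1; rewrite g00 scale1r !add0r mul1r => ->.
Qed.

End hahn_banach.

(** * Bilinearity of the duality pairing *)

Section pairing_theory.
Context (R : realType) (X : tvsType R).
Implicit Types (x y : X) (xs ys : dual X).

Lemma pairing0 xs : pairing 0 xs = 0.
Proof. exact: raddf0. Qed.

Lemma pairingD x y xs : pairing (x + y) xs = pairing x xs + pairing y xs.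
Proof. exact: raddfD. Qed.

Lemma pairingB x y xs : pairing (x - y) xs = pairing x xs - pairing y xs.
Proof. exact: raddfB. Qed.

Lemma pairingZ t x xs : pairing (t *: x) xs = t * pairing x xs.
Proof. exact: linearZ. Qed.

Lemma pairingDr x xs ys : pairing x (xs + ys) = pairing x xs + pairing x ys.
Proof. by []. Qed.

Lemma pairingNr x xs : pairing x (- xs) = - pairing x xs.
Proof. by []. Qed.

Lemma pairingBr x xs ys : pairing x (xs - ys) = pairing x xs - pairing x ys.
Proof. by []. Qed.

Lemma pairingZr x t xs : pairing x (t *: xs) = t * pairing x xs.
Proof. by []. Qed.

End pairing_theory.

(** * Sublinear functions and gauges *)

Section sublinear.
Context (R : realType) (X : tvsType R).
Implicit Types (x y z : X) (p : X -> R).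

Definition sublinear p := (forall y z, p (y + z) <= p y + p z) /\
  (forall t y, 0 < t -> p (t *: y) = t * p y).

Lemma sublinear0 p : sublinear p -> p 0 = 0.
Proof. by move=> [_ /(_ 2 0)]; rewrite scaler0; lra. Qed.

Lemma sublinear_rconvex p : sublinear p -> rconvex p.
Proof.
move=> [pD pZ] x y t /andP[t0 t1]; apply: (le_trans (pD _ _)).
by rewrite !pZ// subr_gt0.
Qed.

Lemma near_scale (c : R) (V : set X) : nbhs 0 V -> \forall y \near (0 : X), V (c *: y).
Proof.
have /= := @scale_continuous R X (c, 0) V; rewrite scaler0 => /[apply] -[B [B1 B2] BV].
near=> y; apply: (BV (c, y)); split; [exact: nbhs_singleton|by near: y; exact: B2].
Unshelve. all: by end_near. Qed.

Lemma near_subl x (V : set X) : nbhs 0 V -> \forall y \near x, V (x - y).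
Proof.
have /= := @sub_continuous X (x, x) V; rewrite subrr => /[apply] -[B [B1 B2] BV].
near=> y; apply: (BV (x, y)); split; [exact: nbhs_singleton|by near: y; exact: B2].
Unshelve. all: by end_near. Qed.

Lemma near_subr x (V : set X) : nbhs 0 V -> \forall y \near x, V (y - x).
Proof.
have /= := @sub_continuous X (x, x) V; rewrite subrr => /[apply] -[B [B1 B2] BV].
near=> y; apply: (BV (y, x)); split; [by near: y; exact: B1|exact: nbhs_singleton].
Unshelve. all: by end_near. Qed.

Lemma near_shift x (V : set X) : nbhs x V -> \forall y \near (0 : X), V (x + y).
Proof.
have /= := @add_continuous X (x, 0) V; rewrite addr0 => /[apply] -[B [B1 B2] BV].
near=> y; apply: (BV (x, y)); split; [exact: nbhs_singleton|by near: y; exact: B2].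
Unshelve. all: by end_near. Qed.

Lemma sublinear_near0 p : sublinear p -> (\forall y \near (0 : X), p y <= 1) ->
  forall e, 0 < e -> \forall y \near (0 : X), p y < e.
Proof.
move=> [_ pZ] p1 e e0; near=> y.
have : p ((2 / e) *: y) <= 1 by near: y; exact: (@near_scale _ [set y | p y <= 1]).
rewrite pZ ?divr_gt0// mulrAC ler_pdivrMr//; lra.
Unshelve. all: by end_near. Qed.

Lemma near_absorb (V : set X) y : nbhs 0 V -> exists2 t, 0 < t & V (t^-1 *: y).
Proof.
have /= := @scale_continuous R X (0, y) V.
rewrite scale0r => /[apply] -[B [/nbhs_ballP[e /= e0 eB] B2] BV].
exists (2 / e); first by rewrite divr_gt0.
suff eB2 : B.1 (2 / e)^-1 by apply: (BV (_, y)); split => //; exact: nbhs_singleton.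
rewrite invf_div; apply: eB; rewrite /ball /= sub0r normrN gtr0_norm ?divr_gt0//; lra.
Qed.

(** The Minkowski gauge of a convex basic neighbourhood [b] of 0 inside [W]. Since [b] need not be
    symmetric, [p z] and [p (- z)] may differ. *)
Lemma gauge_exists (W : set X) : nbhs 0 W ->
  exists p, [/\ sublinear p, forall y, 0 <= p y,
    \forall y \near (0 : X), p y <= 1 & forall y, p y < 1 -> W y].
Proof.
move=> W0; have [B convB [openB basisB]] := @locally_convex R X.
have [b [Bb b0] bW] := basisB 0 W W0.
have nb : nbhs 0 b by apply: open_nbhs_nbhs; split => //; exact: openB.
have {}convB x y t : 0 < t < 1 -> b x -> b y -> b (t *: x + (1 - t) *: y).
  move=> /andP[t0 t1] bx by_.
  have t01 : Itv.spec (@Itv.num_sem R) (Itv.Real `[0%Z, 1%Z]) t.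
    by apply/and3P; split; rewrite ?bnd_simp/= ?num_real// ltW.
  have := convB b; rewrite inE => /(_ Bb) /(_ x y (Itv.mk t01)).
  by rewrite !inE; exact.
pose S y := [set t : R | 0 < t /\ b (t^-1 *: y)].
have infS y : has_inf (S y).
  split; last by exists 0 => t [/ltW].
  by have [t t0 bt] := near_absorb y nb; exists t.
(* [b] is convex and contains 0, so it contains [s^-1 *: y], which lies between 0 and
   [t^-1 *: y]. *)
have Sup y t s : S y t -> t <= s -> S y s.
  move=> [t0 bt] ts; split; first exact: lt_le_trans ts.
  have [->//|ne] := eqVneq s t; have {}ts : t < s by rewrite lt_neqAle eq_sym ne.
  have s0 : 0 < s by exact: lt_trans ts.
  have := convB (t^-1 *: y) 0 (t / s).
  rewrite scaler0 addr0 scalerA.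
  have -> : t / s / t = s^-1 by field; lra.
  by apply => //; rewrite divr_gt0//= ltr_pdivrMr// mul1r.
have Slt y s : inf (S y) < s -> S y s.
  by move=> /inf_lt -/(_ (infS y).1)[t St /ltW ts]; exact: Sup ts.
exists (fun y => inf (S y)); split; first split.
- move=> y z; apply/ler_addgt0Pr => e e0.
  have e20 : 0 < e / 2 by lra.
  have [t [t0 bt] te] := inf_adherent e20 (infS y).
  have [s [s0 bs] se] := inf_adherent e20 (infS z).
  have : S (y + z) (t + s).
    split; first exact: addr_gt0.
    have ts0 : 0 < t + s by exact: addr_gt0.
    have := convB (t^-1 *: y) (s^-1 *: z) (t / (t + s)).
    have -> : 1 - t / (t + s) = s / (t + s) by field; lra.
    rewrite !scalerA scalerDr.
    have -> : t / (t + s) / t = (t + s)^-1 by field; lra.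
    have -> : s / (t + s) / s = (t + s)^-1 by field; lra.
    by apply => //; rewrite divr_gt0//= ltr_pdivrMr// mul1r; lra.
  by move=> /(ge_inf (infS _).2); lra.
(* One inequality for all scalars suffices: the converse is the same one for [t^-1] at [t *: y]. *)
- have half t y : 0 < t -> inf (S (t *: y)) <= t * inf (S y).
    move=> t0; rewrite -ler_pdivrMl//; apply: lb_le_inf; first exact: (infS y).1.
    move=> s [s0 bs]; rewrite ler_pdivrMl//; apply: (ge_inf (infS _).2).
    split; first exact: mulr_gt0.
    by rewrite scalerA invfM mulrAC mulVf ?gt_eqF// mul1r.
  move=> t y t0; apply/eqP; rewrite eq_le half//= -ler_pdivlMl//.
  have := half t^-1 (t *: y); rewrite scalerA mulVf ?gt_eqF// scale1r.
  by apply; rewrite invr_gt0.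
- by move=> y; apply: lb_le_inf; [exact: (infS y).1|move=> t [/ltW]].
- near=> y; apply: (ge_inf (infS _).2); split => //; rewrite invr1 scale1r.
  by near: y.
- by move=> y /Slt [_]; rewrite invr1 scale1r; exact: bW.
Unshelve. all: by end_near. Qed.

(** The bound at [z] and at [- z] traps [l z] between [- p z] and [p (- z)], both of which are small
    near 0. *)
Lemma dual_of_majorized (l : X -> R^o) p : linear l -> sublinear p ->
  (\forall y \near (0 : X), p y <= 1) -> (forall z, - l z <= p z) ->
  exists xs : dual X, forall z, pairing z xs = l z.
Proof.
move=> lin_l sp p1 lp.
pose L : {linear X -> R^o} := HB.pack l (GRing.isLinear.Build _ _ _ _ l lin_l).
have lB y z : l (y - z) = l y - l z by exact: (raddfB L).
have cl : continuous l.
  move=> x; apply/cvgrPdist_lt => e e0; near=> y.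
  have h1 : p (x - y) < e.
    by near: y; exact: (@near_subl x [set y | p y < e] (sublinear_near0 sp p1 e0)).
  have h2 : p (y - x) < e.
    by near: y; exact: (@near_subr x [set y | p y < e] (sublinear_near0 sp p1 e0)).
  have := lp (x - y); have := lp (y - x); rewrite !lB ltr_norml.
  by move: h1 h2; lra.
have lm : l \in @cont_linear R X by apply/asboolP.
by exists (Dual lm).
Unshelve. all: by end_near. Qed.

End sublinear.

(** * Functions of class Gamma and their subdifferentials *)

Section proper_convex.
Local Open Scope ereal_scope.
Context (R : realType).

Lemma proper_real (T : Type) (f : T -> \bar R) x :
  Defs.proper f -> edom f x -> exists r, f x = r%:E.
Proof.
move=> [_ /(_ x)]; rewrite /edom /=.
by case: (f x) => [r _ _|//|//]; exists r.
Qed.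

(** Real upper bounds replace the values of [f], which keeps infinite sums out of later convexity
    arguments. *)
Lemma econvexP (E : lmodType R) (f : E -> \bar R) : Defs.proper f ->
  econvex f <-> forall x y (a b t : R), (0 < t < 1)%R -> f x <= a%:E -> f y <= b%:E ->
    f (t *: x + (1 - t) *: y)%R <= (t * a + (1 - t) * b)%:E.
Proof.
move=> pf; split=> cf x y => [a b t t01 fa fb|t t01].
  apply: (le_trans (cf x y t t01)); have [t0 t1] := andP t01.
  by rewrite [(_ + (1 - t) * b)%:E]EFinD !EFinM leeD// lee_pmul2l// lte_fin ?subr_gt0.
have [t0 t1] := andP t01; have t1' : (0 < 1 - t)%R by rewrite subr_gt0.
have ty u : (0 < u)%R -> u%:E * +oo = +oo :> \bar R by move=> u0; exact: gt0_muley.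
have [_ pf'] := pf; have := pf' y; have := pf' x.
case fx : (f x) => [r||]// _; case fy : (f y) => [s||]// _.
- by rewrite -!EFinM -EFinD; apply: cf; rewrite ?fx ?fy.
- by rewrite (ty _ t1') -EFinM addey// leey.
- by rewrite (ty _ t0) -EFinM addye// leey.
- by rewrite (ty _ t0) (ty _ t1') leey.
Qed.

End proper_convex.

Section convex_combinations.
Context (R : pzRingType) (V : lmodType R).
Implicit Types (t : R) (u v : V).

Lemma conv_sub t u u' v v' :
  t *: (u - v) + (1 - t) *: (u' - v') =
  (t *: u + (1 - t) *: u') - (t *: v + (1 - t) *: v').
Proof. by rewrite !scalerBr addrACA opprD. Qed.

Lemma conv_same t u : t *: u + (1 - t) *: u = u.
Proof. by rewrite -scalerDl addrC subrK scale1r. Qed.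

End convex_combinations.

Section gamma_theory.
Local Open Scope ereal_scope.
Context (R : realType) (X : tvsType R).
Implicit Types (f : X -> \bar R) (h : X -> R).

Lemma proper_addr f h : Defs.proper f -> Defs.proper (fun y => f y + (h y)%:E).
Proof.
move=> [[x fx] pf]; split; last first.
  by move=> y; have := pf y; case: (f y) => [r||].
by exists x; rewrite /edom /= lte_add_pinfty// ltry.
Qed.

Lemma Gamma_addr f h : Gamma f -> rconvex h ->
  (forall x e, (0 < e)%R -> \forall y \near x, (h x - e < h y)%R) ->
  Gamma (fun y => f y + (h y)%:E).
Proof.
move=> [pf cf lf] ch lh; split; first exact: proper_addr.
- apply/(econvexP (proper_addr h pf)) => x y a b t t01.
  rewrite -!leeBrDr// -!EFinB => fa fb.
  apply: (le_trans ((econvexP pf).1 cf x y _ _ t t01 fa fb)); rewrite lee_fin.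
  by have := ch x y t t01; lra.
- move=> x a; have [_ pf'] := pf.
  (* The level [a] is split into [b] below [f x] and a remainder below [h x]; if [f x] is infinite,
     [b] only has to be large. *)
  move=> /= afx; have [b bf ab] : exists2 b, b%:E < f x & (a < b + h x)%R.
    have := pf' x; move: afx; case: (f x) => [r|_ _|//].
      rewrite -EFinD lte_fin => h1 _; exists ((r + a - h x) / 2)%R; last by lra.
      by rewrite lte_fin; lra.
    by exists (a - h x + 1)%R; [exact: ltry|lra].
  have [V Vx Vf] := lf x b bf.
  have e0 : (0 < b + h x - a)%R by lra.
  have := lh x _ e0 => hx.
  exists (V `&` [set y | h x - (b + h x - a) < h y]%R); first exact: filterI.
  move=> y [/Vf bfy /= hy].
  apply: (@le_lt_trans _ _ (b%:E + (h y)%:E)); last by rewrite lteD2rE.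
  by rewrite -EFinD lee_fin; lra.
Qed.

Lemma subdiff_real f x xs : subdiff f x xs -> exists2 r, f x = r%:E &
  forall y s, f y <= s%:E -> (r + pairing (y - x) xs <= s)%R.
Proof.
move=> [fx fxs]; exists (fine (f x)); first by rewrite fineK.
move=> y s fy; rewrite -lee_fin; apply: le_trans fy.
by rewrite EFinD fineK.
Qed.

Lemma subdiff_of_real f x xs r : Defs.proper f -> f x = r%:E ->
  (forall y s, f y = s%:E -> (r + pairing (y - x) xs <= s)%R) -> subdiff f x xs.
Proof.
move=> [_ pf] fx h; split; first by rewrite fx.
move=> y; rewrite fx -EFinD; have := pf y.
case fy : (f y) => [s||]// _; last exact: leey.
by rewrite lee_fin; exact: h.
Qed.

Lemma subdiff_add_linear f (h : X -> R) x xs ys : Defs.proper f ->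
  (forall y, h y - h x = pairing (y - x) ys)%R ->
  subdiff (fun y => f y + (h y)%:E) x xs -> subdiff f x (xs - ys)%R.
Proof.
move=> pf hys /subdiff_real[r].
have := pf.2 x; case fx : (f x) => [s||]// _ [sr] le_s.
apply: (subdiff_of_real pf fx) => y t fy.
have := le_s y (t + h y)%R; rewrite fy => /(_ (lexx _)).
by have := hys y; rewrite pairingBr; lra.
Qed.

(** A sum rule: [- l] is a subgradient of [p (_ - x)] at [a], which for sublinear [p] means
    [- l <= p] with equality at [a - x]. *)
Lemma subdiff_add_sublinear f (p : X -> R) x a b : Defs.proper f -> econvex f ->
  sublinear p -> (\forall y \near (0%R : X), (p y <= 1)%R) ->
  subdiff (fun y => f y + (p (y - x)%R)%:E) a b ->
  exists2 l : dual X, subdiff f a (b + l)%R & (pairing (a - x) l = - p (a - x))%R.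
Proof.
move=> pf cf sp p1 /subdiff_real[r].
have := pf.2 a; case fa : (f a) => [fa'||]// _ [rE] le_r.
(* With this [d], the subgradient inequality at [a] for the sum reads [- p (y - x) <= d y]. *)
pose d y := (fine (f y) - fa' - pairing (y - a) b - p (a - x))%R.
have d_ge y s : f y = s%:E -> (- p (y - x) <= d y)%R.
  move=> fy; have := le_r y (s + p (y - x))%R; rewrite fy => /(_ (lexx _)).
  by rewrite /d fy /=; lra.
(* A linear l below w |-> inf_y d(y) + p(y - x - w) satisfies l(y - x) <= d(y)
   at w = y - x, and - l <= p by homogeneity. *)
pose S w := [set d y + p (y - x - w) | y in edom f]%R.
have infS w : has_inf (S w).
  split; first by have [[y fy] _] := pf; exists (d y + p (y - x - w))%R, y.
  exists (- p w)%R => _ [y fy <-]; have [s fs] := proper_real pf fy.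
  by have := d_ge _ _ fs; have := sp.1 (y - x - w)%R w; rewrite subrK; lra.
have cS : rconvex (fun w => inf (S w)).
  apply: rconvex_inf => // w w' t _ _ t01 [y fy <-] [y' fy' <-].
  have [s fs] := proper_real pf fy; have [s' fs'] := proper_real pf fy'.
  have := (econvexP pf).1 cf y y' s s' t t01; rewrite fs fs' => /(_ (lexx _) (lexx _)).
  set z := (t *: y + _)%R => fz.
  have domz : edom f z by rewrite /edom /= (le_lt_trans fz)// ltry.
  exists (d z + p (z - x - (t *: w + (1 - t) *: w')))%R; first by exists z.
  have [s1 fs1] := proper_real pf domz.
  move: fz; rewrite /d fs1 fs fs' lee_fin /= => fz.
  have -> : (z - x - (t *: w + (1 - t) *: w') =
      t *: (y - x - w) + (1 - t) *: (y' - x - w'))%R.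
    by rewrite !conv_sub conv_same.
  have -> : (z - a = t *: (y - a) + (1 - t) *: (y' - a))%R.
    by rewrite conv_sub conv_same.
  have := sublinear_rconvex sp (y - x - w)%R (y' - x - w')%R t01.
  rewrite [pairing (t *: _ + _)%R _]pairingD !pairingZ; lra.
have S0 : (0 <= inf (S 0))%R.
  apply: lb_le_inf; first exact: (infS 0%R).1.
  move=> _ [y fy <-]; have [s fs] := proper_real pf fy.
  by have := d_ge _ _ fs; rewrite subr0; lra.
have [l lin_l lS] := hahn_banach_convex cS S0.
have l_le y w s : f y = s%:E -> (l w <= d y + p (y - x - w))%R.
  move=> fy; apply: (le_trans (lS w)); apply: (ge_inf (infS w).2).
  by exists y => //; rewrite /edom /= fy ltry.
pose L : {linear X -> R^o} := HB.pack l (GRing.isLinear.Build _ _ _ _ l lin_l).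
have lB y z : (l (y - z) = l y - l z)%R by exact: (raddfB L).
have lZ t z : (l (t *: z) = t * l z)%R.
  have := lin_l t z 0%R; have -> : l 0%R = 0%R by exact: (raddf0 L).
  by rewrite !addr0.
have dfa : (d a = - p (a - x))%R.
  by rewrite /d fa /= !subrr pairing0; lra.
have lp z : (- l z <= p z)%R.
  (* Otherwise [l_le] at [y = a], [w = a - x - s *: z] bounds [s * (- l z - p z)] by [C] for all
     positive [s]; the chosen [s] makes it [|C| + 1]. *)
  rewrite leNgt; apply/negP => lt_z.
  pose C := (d a - l (a - x))%R; pose s := ((`|C| + 1) / (- l z - p z))%R.
  have e0 : (0 < - l z - p z)%R by lra.
  have s0 : (0 < s)%R by rewrite divr_gt0// ltr_wpDl.
  have := l_le a (a - x - s *: z)%R _ fa; rewrite lB lZ.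
  have -> : (a - x - (a - x - s *: z) = s *: z)%R by rewrite opprB addrC subrK.
  rewrite sp.2//.
  have : (s * (- l z - p z) = `|C| + 1)%R by rewrite divfK ?gt_eqF.
  have := ler_norm C; rewrite {1}/C; nra.
have [xs xsE] := dual_of_majorized lin_l sp p1 lp.
have lax : (l (a - x) = - p (a - x))%R.
  have := l_le a (a - x)%R _ fa; rewrite dfa subrr (sublinear0 sp).
  have := lp (a - x)%R; lra.
exists xs; last by rewrite xsE.
apply: (subdiff_of_real pf fa) => y s fy.
have := l_le y (y - x)%R s fy; rewrite subrr (sublinear0 sp) addr0.
have := xsE (y - a)%R; rewrite pairingDr => ->.
have -> : (y - a = y - x - (a - x))%R by rewrite opprB addrA subrK.
rewrite [l (y - x - _)%R]lB lax /d fy /=.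
have -> : (y - x - (a - x) = y - a)%R by rewrite opprB addrA subrK.
lra.
Qed.

End gamma_theory.

(** * Infimal convolution along a segment *)

Section segment_convolution.
Local Open Scope ereal_scope.
Context (R : realType) (X : tvsType R).
Implicit Types (f : X -> \bar R) (v y : X) (N t : R).

Lemma ereal_between (a b : \bar R) : a < b -> exists2 c : R, a < c%:E & c%:E < b.
Proof.
case: a => [r||]; case: b => [s||]//.
- by rewrite lte_fin => rs; exists ((r + s) / 2)%R; rewrite lte_fin; lra.
- by move=> _; exists (r + 1)%R; rewrite ?ltry// lte_fin; lra.
- by move=> _; exists (s - 1)%R; rewrite ?ltNyr// lte_fin; lra.
- by move=> _; exists 0%R; rewrite ?ltry ?ltNyr.
Qed.

Lemma near_sub_scale y t v (V : set X) : nbhs (y - t *: v)%R V ->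
  exists A : set X * set R, [/\ nbhs y A.1, nbhs t A.2 &
    forall y' t', A.1 y' -> A.2 t' -> V (y' - t' *: v)%R].
Proof.
have /= := @sub_continuous X (y, (t *: v)%R) V => /[apply] -[B [B1 B2] BV].
have /= := @scale_continuous R X (t, v) B.2 B2 => -[C [C1 C2] CB].
exists (B.1, C.1); split => // y' t' By Ct; apply: (BV (y', (t' *: v)%R)).
split => //; apply: (CB (t', v)); split => //; exact: nbhs_singleton.
Qed.

Definition segment_term f v N y t := f (y - t *: v)%R + (N * `|t|)%:E.

Definition segment_conv f v N y :=
  ereal_inf [set segment_term f v N y t | t in `[(-1)%R, 1%R]%classic].

(** Lower semicontinuity jointly in [y] and [t], the form that the compactness arguments over
    [[-1, 1]] consume. *)
Lemma segment_term_lsc f v N y t (c : R) : Gamma f -> (0 <= N)%R ->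
  c%:E < segment_term f v N y t ->
  exists A : set X * set R, [/\ nbhs y A.1, nbhs t A.2 &
    forall y' t', A.1 y' -> A.2 t' -> c%:E < segment_term f v N y' t'].
Proof.
move=> [[_ pf] _ lf] N0 cF.
have [b bf cb] : exists2 b, b%:E < f (y - t *: v)%R & (c < b + N * `|t|)%R.
  move: cF; rewrite /segment_term -lteBlDr// -EFinB => /ereal_between[b].
  by rewrite lte_fin => cb bf; exists b => //; lra.
have [V Vy Vf] := lf _ _ bf.
have [[A1 A2] /= [yA1 tA2 AV]] := near_sub_scale Vy.
have tW : nbhs t [set s | c < b + N * `|s|]%R.
  (* Dividing the slack by [N + 1] rather than [N] covers [N = 0]. *)
  have e0 : (0 < (b + N * `|t| - c) / (N + 1))%R.
    by apply: divr_gt0; [lra|lra].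
  apply/nbhs_ballP; exists ((b + N * `|t| - c) / (N + 1))%R => //= s.
  rewrite /ball /= ltr_pdivlMr; last lra.
  have := ler_distD t s 0%R; have := ler_distD s t 0%R; rewrite !subr0 distrC.
  have := normr_ge0 (s - t)%R; nra.
exists (A1, A2 `&` [set s | c < b + N * `|s|]%R); split => //=; first exact: filterI.
move=> y' t' /AV Ay [/Ay/Vf bfy /= cbN].
rewrite /segment_term; apply: (@le_lt_trans _ _ (b%:E + (N * `|t'|)%:E)).
  by rewrite -EFinD lee_fin ltW.
by rewrite lteD2rE.
Qed.

Lemma segment_conv_le f v N y t : (`|t| <= 1)%R ->
  segment_conv f v N y <= segment_term f v N y t.
Proof.
move=> t1; apply: ereal_inf_lbound; exists t => //=.
by rewrite in_itv /= -ler_norml.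
Qed.

(** If the infimum [m] were not attained, compactness of [[-1, 1]] would give one real [c > m] below
    all the terms. *)
Lemma segment_conv_attained f v N y : Gamma f -> (0 <= N)%R ->
  exists2 t, (`|t| <= 1)%R & segment_conv f v N y = segment_term f v N y t.
Proof.
move=> Gf N0; apply: contrapT => nex.
set m := segment_conv f v N y in nex *.
have m_lt t : `[(-1)%R, 1%R]%classic t -> m < segment_term f v N y t.
  rewrite /= in_itv /= -ler_norml => t1.
  rewrite lt_neqAle segment_conv_le// andbT; apply/eqP => mt.
  by apply: nex; exists t.
have t00 : `[(-1)%R, 1%R]%classic (0%R : R).
  by rewrite /= in_itv /= -ler_norml normr0 ler01.
(* The filter of reals decreasing to [m] from above; it makes sense even if [m] is [-oo], which is
   not yet excluded. *)
pose G := filter_from [set c : R | m < c%:E] (fun c => [set d | m < d%:E /\ (d <= c)%R]).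
have FG : Filter G.
  apply: filter_from_filter.
    by have [c mc _] := ereal_between (m_lt _ t00); exists c.
  move=> c d mc md; exists (Num.min c d); first by rewrite /=; have [_|_] := leP c d.
  by move=> s /= [ms]; rewrite le_min => /andP[sc sd].
have cK : compact `[(-1)%R, (1%R : R)]%classic by exact: segment_compact.
have /compact_near_coveringP/(_ R G (fun c t => c%:E < segment_term f v N y t) FG) := cK.
case.
  move=> t /m_lt/ereal_between[c mc cF].
  have [A [yA tA Ac]] := segment_term_lsc Gf N0 cF.
  exists (A.2, [set d | m < d%:E /\ (d <= c)%R]).
    by split => //=; exists c.
  move=> [s d] /= [As [_ dc]]; apply: (@le_lt_trans _ _ c%:E); first by rewrite lee_fin.
  by apply: Ac => //; exact: nbhs_singleton.
move=> c /= mc cP; have [mc' cK'] : m < c%:E /\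
    `[(-1)%R, 1%R]%classic `<=` (fun t => c%:E < segment_term f v N y t).
  by split => //; apply: cP; split.
have : c%:E <= m by apply: le_ereal_inf_tmp => _ [t /cK' /ltW + <-].
by rewrite leNgt mc'.
Qed.

(** Properness and convexity are read off minimizers, since the combination of two minimizing
    parameters is admissible. Lower semicontinuity is that of the terms, made uniform over [[-1, 1]]
    by compactness. *)
Lemma Gamma_segment_conv f v N : Gamma f -> (0 <= N)%R -> Gamma (segment_conv f v N).
Proof.
move=> Gf N0; have [pf cf lf] := Gf.
have pg : Defs.proper (segment_conv f v N).
  split; last first.
    move=> y; have [t _ ->] := segment_conv_attained v y Gf N0.
    rewrite /segment_term; have := pf.2 (y - t *: v)%R.
    by case: (f _) => [r||].
  have [[x fx] _] := pf; exists x; rewrite /edom /=.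
  apply: (@le_lt_trans _ _ (segment_term f v N x 0)).
    apply: segment_conv_le; rewrite normr0; exact: ler01.
  by rewrite /segment_term scale0r subr0 lte_add_pinfty// ltry.
split => //.
- apply/(econvexP pg) => x y a b t t01.
  have [r r1 ->] := segment_conv_attained v x Gf N0.
  have [s s1 ->] := segment_conv_attained v y Gf N0.
  rewrite /segment_term -!leeBrDr// -!EFinB => fa fb.
  have := (econvexP pf).1 cf _ _ _ _ t t01 fa fb.
  rewrite conv_sub !scalerA -scalerDl => h.
  have [t0 t1] := andP t01.
  have rs : (`|t * r + (1 - t) * s| <= t * `|r| + (1 - t) * `|s|)%R.
    apply: (le_trans (ler_normD _ _)).
    by rewrite !normrM (gtr0_norm t0) (@gtr0_norm _ (1 - t))// subr_gt0.
  apply: (@le_trans _ _ (segment_term f v N (t *: x + (1 - t) *: y)%R (t * r + (1 - t) * s)%R)).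
    by apply: segment_conv_le; nra.
  rewrite /segment_term -leeBrDr// -EFinB; apply: (le_trans h).
  by rewrite lee_fin; nra.
- move=> y c cy.
  have cK : compact `[(-1)%R, (1%R : R)]%classic by exact: segment_compact.
  have /compact_near_coveringP/(_ X (nbhs y)
    (fun y' t => c%:E < segment_term f v N y' t) (nbhs_filter y)) cov := cK.
  exists [set y' | `[(-1)%R, 1%R]%classic `<=` (fun t => c%:E < segment_term f v N y' t)].
    apply: cov => t /=; rewrite in_itv /= -ler_norml => t1.
    have [A [yA tA Ac]] := segment_term_lsc Gf N0 (lt_le_trans cy (segment_conv_le f v N y t1)).
    by exists (A.2, A.1) => //= -[s y'] /= [As Ay]; exact: Ac.
  move=> y' /=.
  have [t t1 ->] := segment_conv_attained v y' Gf N0; apply.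
  by rewrite /= in_itv /= -ler_norml.
Qed.

Lemma subdiff_segment_conv f v N y ys : Gamma f -> (0 <= N)%R ->
  subdiff (segment_conv f v N) y ys ->
  exists t, [/\ (`|t| <= 1)%R, segment_conv f v N y = segment_term f v N y t,
    subdiff f (y - t *: v)%R ys, (N * `|t| <= t * pairing v ys)%R &
    (`|pairing v ys| - N <= t * pairing v ys - N * `|t|)%R].
Proof.
move=> Gf N0 /subdiff_real[r gy le_r].
have [t t1 gt] := segment_conv_attained v y Gf N0.
have [s fs] : exists s, f (y - t *: v)%R = s%:E.
  have [[_ /(_ (y - t *: v)%R)]] := Gf.
  move: gy; rewrite gt /segment_term.
  by case: (f _) => [s||]//; exists s.
have rE : r = (s + N * `|t|)%R by apply: EFin_inj; rewrite -gy gt /segment_term fs.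
(* Testing the subgradient inequality at [y - t *: v + u *: v] shows that [t] maximizes
   [u * pairing v ys - N * |u|] on [[-1, 1]]. The last two claims compare it with [u = 0] and with
   [u = 1] or [u = -1], by the sign of [pairing v ys]. *)
have slope u : (`|u| <= 1)%R -> (u * pairing v ys - N * `|u| <= t * pairing v ys - N * `|t|)%R.
  move=> u1; have := le_r (y - t *: v + u *: v)%R (s + N * `|u|)%R.
  have -> : (y - t *: v + u *: v - y = (u - t) *: v)%R.
    by rewrite scalerBl addrC !addrA addNr add0r addrC.
  rewrite pairingZ rE => h.
  have : segment_conv f v N (y - t *: v + u *: v)%R <= (s + N * `|u|)%:E.
    apply: (le_trans (segment_conv_le _ _ _ _ u1)).
    by rewrite /segment_term addrK fs EFinD.
  by move=> /h; lra.
exists t; split => //.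
- have [pf _ _] := Gf; apply: (subdiff_of_real pf fs) => w q fw.
  have := le_r (w + t *: v)%R (q + N * `|t|)%R.
  have -> : (w + t *: v - y = w - (y - t *: v))%R by rewrite opprB addrA.
  rewrite rE => h.
  have : segment_conv f v N (w + t *: v)%R <= (q + N * `|t|)%:E.
    apply: (le_trans (segment_conv_le _ _ _ _ t1)).
    by rewrite /segment_term addrK fw EFinD.
  by move=> /h; lra.
- by have := slope 0%R; rewrite normr0 ler01 => /(_ isT); lra.
- have [v0|v0] := leP 0%R (pairing v ys).
    by have := slope 1%R; rewrite normr1 lexx => /(_ isT); rewrite (ger0_norm v0); lra.
  by have := slope (-1)%R; rewrite normrN1 lexx => /(_ isT); rewrite (ltr0_norm v0); lra.
Qed.

End segment_convolution.

(** * Consequences of (vii) *)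

Section approximable.
Context (R : realType) (X : tvsType R).
Implicit Types (f : X -> \bar R) (x y v : X) (V : set X) (e : R).

(** Condition (vii), the hub through which the other conditions are derived. *)
Definition approximable := forall f, Gamma f -> forall x, edom f x ->
  forall e, 0 < e ->
  exists2 a : X * dual X, Graph (subdiff f) a & - e <= pairing (x - a.1) a.2.

Hypothesis approx : approximable.

Lemma approx_penalized f x (p : X -> R) e : Gamma f -> edom f x -> sublinear p ->
  (\forall y \near (0 : X), p y <= 1) -> 0 < e ->
  exists2 a : X * dual X, Graph (subdiff f) a &
    - e + p (a.1 - x) <= pairing (x - a.1) a.2.
Proof.
move=> Gf fx sp p1 e0; have [pf cf _] := Gf.
have Gg : Gamma (fun y => f y + (p (y - x)%R)%:E)%E.
  apply: Gamma_addr => // [y z t t01|y d d0].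
    by rewrite -{1}(conv_same t x) -conv_sub; exact: sublinear_rconvex.
  near=> z; have : p (y - z) < d.
    by near: z; exact: (@near_subl _ _ y [set w | p w < d] (sublinear_near0 sp p1 d0)).
  by have := sp.1 (z - x) (y - z); rewrite addrC addrA subrK; lra.
have gx : edom (fun y => f y + (p (y - x)%R)%:E)%E x.
  by rewrite /edom /= subrr (sublinear0 sp) adde0.
have [[a b] /= ab eb] := approx Gg gx e0.
have [l la lE] := subdiff_add_sublinear pf cf sp p1 ab.
exists (a, b + l) => //; rewrite /= in lE eb; rewrite -[leRHS]/(pairing (x - a) (b + l)).
by move: lE eb; rewrite pairingDr !pairingB /=; lra.
Unshelve. all: by end_near. Qed.

Lemma near_pairing (xs : dual X) e : 0 < e ->
  \forall y \near (0 : X), `|pairing y xs| < e.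
Proof.
move=> e0; have /cvgrPdist_lt/(_ e e0) := @dual_fun_continuous R X xs 0.
apply: filterS => y; rewrite -/(pairing y xs) -/(pairing 0 xs) pairing0.
by rewrite sub0r normrN.
Qed.

Lemma approx_near f x V e : Gamma f -> edom f x -> nbhs x V -> 0 < e ->
  exists a : X * dual X, [/\ Graph (subdiff f) a, V a.1 &
    - e <= pairing (x - a.1) a.2].
Proof.
move=> Gf fx Vx e0; have [pf _ _] := Gf.
have [r fr] := proper_real pf fx.
have [[b bs] /= /subdiff_real[rb _ minor] _] := approx Gf fx ltr01.
have [p [sp p0 p1 pV]] := gauge_exists (near_shift Vx).
(* The subgradient inequality between [a] and [x] and the affine minorant at [b] give
   [K * p (a - x) <= K - 1], hence [p (a - x) < 1]. *)
pose K := 1 + e + `|r - rb - pairing (x - b) bs|.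
have K0 : 0 < K by have := normr_ge0 (r - rb - pairing (x - b) bs); rewrite /K; lra.
(* The summand |<y, bs>| compensates the slope of the affine minorant of f
   given by the subgradient bs at b. *)
pose q y := K * p y + `|pairing y bs|.
have sq : sublinear q.
  split=> [y z|t y t0]; rewrite /q.
    rewrite pairingD; have := ler_normD (pairing y bs) (pairing z bs).
    have := sp.1 y z; nra.
  by rewrite sp.2// pairingZ normrM gtr0_norm// mulrDr mulrCA.
have q1 : \forall y \near (0 : X), q y <= 1.
  near=> y; have h0 : (0 : R) < 2^-1 by lra.
  have h1 : `|pairing y bs| < 2^-1 by near: y; exact: near_pairing.
  have h2 : p y < 2^-1 / K.
    near: y; apply: sublinear_near0 => //; exact: divr_gt0.
  by rewrite /q; move: h2; rewrite ltr_pdivlMr//; lra.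
have [[a as_] /= sa ea] := approx_penalized Gf fx sq q1 e0.
have [ra fa le_ra] := subdiff_real sa.
exists (a, as_); split => //=.
  have -> : a = x + (a - x) by rewrite addrC subrK.
  apply: pV; rewrite -(ltr_pM2l K0) mulr1.
  have := le_ra x r; rewrite fr => /(_ (lexx _)).
  have := minor a ra; rewrite fa => /(_ (lexx _)).
  have := ler_norm (r - rb - pairing (x - b) bs).
  have := ler_norm (- pairing (a - x) bs); rewrite normrN.
  move: ea; rewrite /q /K !pairingB; lra.
by apply: le_trans ea; rewrite lerDl /q addr_ge0// mulr_ge0// ltW.
Unshelve. all: by end_near. Qed.

(** Lower semicontinuity bounds [f a.1] from below near [x]. The bound [f a.1 <= f x] comes from a
    slight move towards a point of smaller value; a global minimizer [x] is paired with the zero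
    functional. *)
Lemma approx_near_below f x V e : Gamma f -> edom f x -> nbhs x V -> 0 < e ->
  exists a : X * dual X, [/\ Graph (subdiff f) a, V a.1,
    (f a.1 <= f x)%E, (f x - e%:E <= f a.1)%E &
    - e <= pairing (x - a.1) a.2].
Proof.
move=> Gf fx Vx e0; have [pf cf lf] := Gf.
have [r fr] := proper_real pf fx.
have [xmin|] := pselect (forall u, (f x <= f u)%E).
  exists (x, 0); split => //=.
  - split; first by rewrite fr.
    by move=> y; rewrite -[pairing _ _]/(0 : R) adde0.
  - exact: nbhs_singleton.
  - by rewrite fr -EFinB lee_fin; lra.
  - by rewrite -[leRHS]/(0 : R) oppr_le0 ltW.
move=> /existsNP[u /negP]; rewrite -ltNge => ux.
have [s fs] := proper_real pf (lt_trans ux fx).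
move: ux; rewrite fs fr lte_fin => sr.
(* [d <= r - s] ensures [s < f a], so the slope from [a] to [u] is negative; [d <= e] gives the
   lower bound on [f a]. *)
pose d := Num.min e (r - s).
have d0 : 0 < d by rewrite lt_min e0 subr_gt0.
have [de drs] : d <= e /\ d <= r - s by rewrite /d !ge_min !lexx orbT.
(* Approximate at xt = t u + (1 - t) x instead of x: since f(xt) is smaller
   than f(x) by t (r - s), the point a found near xt has f(a) <= f(x). *)
have [W xW Wf] : exists2 W, nbhs x W & forall y, W y -> ((r - d)%:E < f y)%E.
  by apply: lf; rewrite fr lte_fin; lra.
have [U xU UV] : exists2 U, open_nbhs x U & U `<=` V `&` W.
  by have : nbhs x (V `&` W) by [exact: filterI]; rewrite nbhsE.
have [A [xA tA AU]] : exists A : set X * set R, [/\ nbhs x A.1, nbhs (0 : R) A.2 &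
    forall y' t', A.1 y' -> A.2 t' -> U (y' - t' *: (x - u))].
  by apply: near_sub_scale; rewrite scale0r subr0; exact: open_nbhs_nbhs.
have [t [t0 t1 At]] : exists t : R, [/\ 0 < t, t < 2^-1 & A.2 t].
  move: tA => /nbhs_ballP[c /= c0 cA]; exists (Num.min (c / 2) 3^-1).
  split; first by rewrite lt_min divr_gt0//=; lra.
    by rewrite gt_min; apply/orP; right; lra.
  apply: cA; rewrite /ball /= sub0r normrN ger0_norm; last first.
    by rewrite le_min divr_ge0 ?ltW//=; lra.
  by rewrite gt_min; apply/orP; left; lra.
have xtE : x - t *: (x - u) = t *: u + (1 - t) *: x.
  by rewrite scalerBr opprB addrCA scalerBl scale1r.
have Ut : U (t *: u + (1 - t) *: x).
  by rewrite -xtE; apply: AU => //; exact: nbhs_singleton.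
set xt := t *: u + (1 - t) *: x in xtE Ut.
have fxt : (f xt <= (t * s + (1 - t) * r)%:E)%E.
  by apply: (econvexP pf).1 => //; rewrite ?fs ?fr// t0; lra.
(* The tolerance [t * (r - s)] is exactly the decrease of the bound on [f xt] below [r], whence
   [f a <= r]; the tolerance [e / 2] and [t < 1/2] give the final bound [- e]. *)
have e'0 : 0 < Num.min (t * (r - s)) (e / 2).
  by rewrite lt_min mulr_gt0 ?subr_gt0//=; lra.
have [||[a as_] /= [sa Ua ea]] := @approx_near f xt U _ Gf _ _ e'0.
- by rewrite /edom /= (le_lt_trans fxt)// ltry.
- by apply: open_nbhs_nbhs; split => //; case: xU.
have {}ea : - (t * (r - s)) <= pairing (xt - a) as_ /\ - (e / 2) <= pairing (xt - a) as_.
  by split; apply: le_trans ea; rewrite lerN2 ge_min lexx ?orbT.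
have [ra fa le_ra] := subdiff_real sa.
have [Va /Wf] := UV _ Ua; rewrite fa lte_fin => ra_gt.
have le_xt := le_ra _ _ fxt.
have le_u : ra + pairing (u - a) as_ <= s by apply: le_ra; rewrite fs.
have xta : xt - a = t *: (u - a) + (1 - t) *: (x - a) by rewrite conv_sub conv_same.
move: ea le_xt; rewrite xta [pairing (t *: _ + _) _]pairingD !pairingZ => -[ea1 ea2] le_xt.
exists (a, as_); split; rewrite //= ?fa ?fr ?lee_fin ?EFinB ?lee_fin; first by nra.
  by lra.
have : - (e / 2) <= (1 - t) * pairing (x - a) as_.
  by have : t * pairing (u - a) as_ <= 0 by [nra]; lra.
nra.
Qed.

End approximable.

(** * Low-upper envelope and maximal monotonicity *)

Section consequences.
Context (R : realType) (X : tvsType R).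
Implicit Types (f : X -> \bar R) (x y v : X) (V : set X) (e : R).

Lemma low_upper_le f x : (low_upper f x <= f x)%E.
Proof.
apply: ge_ereal_sup => _ [[a as_] /= [[_ sa] _] <-].
by rewrite addeC.
Qed.

Lemma Gamma_add_linear f (xs : dual X) : Gamma f ->
  Gamma (fun y => f y + (pairing y xs)%:E)%E.
Proof.
move=> Gf; apply: Gamma_addr => // [x y t _|x e e0].
  by rewrite pairingD !pairingZ.
near=> y; have : `|pairing (x - y) xs| < e.
  by near: y; exact: (@near_subl _ _ x [set z | `|pairing z xs| < e] (near_pairing _ e0)).
by move/ltr_normlW; rewrite pairingB; lra.
Unshelve. all: by end_near. Qed.

Lemma subdiff_monotone f p q : Graph (subdiff f) p -> Graph (subdiff f) q ->
  0 <= pairing (p.1 - q.1) (p.2 - q.2).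
Proof.
case: p q => [a as_] [b bs] /= /subdiff_real[r fa ha] /subdiff_real[s fb hb].
have := ha b s; rewrite fb lexx => /(_ isT).
have := hb a r; rewrite fa lexx => /(_ isT) hab hba.
suff: 0 <= pairing (a - b) (as_ - bs) by [].
by move: hab hba; rewrite pairingBr !pairingB; lra.
Qed.

Hypothesis approx : approximable X.

Lemma approx_low_upper_dom f x : Gamma f -> edom f x -> f x = low_upper f x.
Proof.
move=> Gf fx; apply/eqP; rewrite eq_le low_upper_le andbT.
have [pf _ _] := Gf; have [r fr] := proper_real pf fx.
apply/lee_addgt0Pr => e e0; have e20 : 0 < e / 2 by lra.
have [[a as_] /= [sa _ fax fae ea]] :=
  approx_near_below approx Gf fx (filterT : nbhs x setT) e20.
have [s fs _] := subdiff_real sa.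
apply: (@le_trans _ _ ((pairing (x - a) as_)%:E + f a + e%:E)%E).
  by move: fae; rewrite fs fr -EFinB lee_fin -!EFinD lee_fin; lra.
rewrite leeD2r//; apply: ereal_sup_ubound.
by exists (a, as_) => //; split.
Qed.

(** [segment_conv f v N x] is finite but at least [M + 2]. The 2 pays for a loss of 1 in the value
    at [y] and of 1 in the pairing; the constraint [f a.1 <= f x] is free as [f x = +oo]. *)
Lemma approx_low_upper_out f x : Gamma f -> ~ edom f x -> low_upper f x = +oo%E.
Proof.
move=> Gf nfx; have [pf cf lf] := Gf.
have fx : f x = +oo%E by move: nfx; rewrite /edom /=; case: (f x) => [r|//|]; rewrite ?ltry ?ltNyr.
have [[u fu] _] := pf; have [s fs] := proper_real pf fu.
pose v := x - u; have xv : x - v = u by rewrite /v opprB addrC subrK.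
suff big (M : R) : (M%:E <= low_upper f x)%E.
  by apply/eqyP => M _; exact: big.
have [m mg] : exists m : R, (m%:E <= segment_conv f v 0 x)%E.
  have [[_ gNy] _ _] := Gamma_segment_conv v Gf (lexx 0); move: (gNy x).
  by case: (segment_conv _ _ _ _) => [m _|_|//]; [exists m|exists 0; rewrite leey].
have [W xW Wf] : exists2 W, nbhs x W & forall y, W y -> ((M + 2)%:E < f y)%E.
  by apply: lf; rewrite fx ltry.
have [A [xA tA AW]] : exists A : set X * set R, [/\ nbhs x A.1, nbhs (0 : R) A.2 &
    forall y' t', A.1 y' -> A.2 t' -> W (y' - t' *: v)].
  by apply: near_sub_scale; rewrite scale0r subr0.
move: tA => /nbhs_ballP[d /= d0 dA].
(* For [|t| < d] the values of [f] near [x] already exceed [M + 2]; for [|t| >= d] the penalty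
   [N * d] lifts the lower bound [m] of [f] on the segment to that level. *)
pose N := `|M + 2 - m| / d.
have N0 : 0 <= N by rewrite divr_ge0// ltW.
have Mg : ((M + 2)%:E <= segment_conv f v N x)%E.
  have [t t1 ->] := segment_conv_attained v x Gf N0.
  have Nt : 0 <= N * `|t| by exact: mulr_ge0.
  have [td|td] := ltP `|t| d.
    have : ((M + 2)%:E < f (x - t *: v)%R)%E.
      apply/Wf/AW; first exact: nbhs_singleton.
      by apply: dA; rewrite /ball /= sub0r normrN.
    by move=> /ltW h; rewrite /segment_term -[leLHS]adde0 leeD// lee_fin.
  have := le_trans mg (segment_conv_le f v 0 x t1).
  rewrite /segment_term mul0r adde0 => h.
  apply: (@le_trans _ _ (m%:E + (N * `|t|)%:E)%E); last by rewrite leeD2r.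
  rewrite -EFinD lee_fin.
  have : N * d <= N * `|t| by exact: ler_wpM2l.
  by rewrite /N divfK ?gt_eqF//; have := ler_norm (M + 2 - m); lra.
have Gg := Gamma_segment_conv v Gf N0.
have gx : edom (segment_conv f v N) x.
  rewrite /edom /=; apply: (@le_lt_trans _ _ (segment_term f v N x 1)).
    by apply: segment_conv_le; rewrite normr1.
  by rewrite /segment_term scale1r xv fs -EFinD ltry.
have [[y ys] /= [sy _ _ gy ey]] :=
  approx_near_below approx Gg gx (filterT : nbhs x setT) ltr01.
have [q gq _] := subdiff_real sy.
have [t [t1 gt sz Nt _]] := subdiff_segment_conv Gf N0 sy.
rewrite /= in gq gt sz Nt *.
have [z fz _] := subdiff_real sz.
apply: le_ereal_sup_tmp; exists ((pairing (x - (y - t *: v)) ys)%:E + f (y - t *: v)%R)%E.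
  by exists (y - t *: v, ys) => //=; split => //=; rewrite fx leey.
have qE : q = z + N * `|t| by apply: EFin_inj; rewrite -gq gt /segment_term fz.
rewrite fz -EFinD lee_fin.
have [w gw] := proper_real (let: And3 p _ _ := Gg in p) gx.
move: Mg gy; rewrite gw gq -EFinB !lee_fin.
by move: ey; rewrite !pairingB pairingZ; lra.
Qed.

Lemma approx_low_upper f : Gamma f -> f = low_upper f.
Proof.
move=> Gf; apply/funext => x; have [fx|nfx] := pselect (edom f x).
  exact: approx_low_upper_dom.
rewrite approx_low_upper_out//; move: nfx; rewrite /edom /=.
by case: (f x) => [r|//|]; rewrite ?ltry ?ltNyr.
Qed.

(** This is maximality at the pair [(x, 0)]: monotone relation to the graph forces [x] to be a
    global minimizer. *)
Lemma approx_minimum f x : Gamma f ->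
  (forall a, Graph (subdiff f) a -> pairing (x - a.1) a.2 <= 0) ->
  forall u, (f x <= f u)%E.
Proof.
move=> Gf neg u; rewrite leNgt; apply/negP => ux; have [pf cf lf] := Gf.
have [c uc cx] := ereal_between ux.
have fu : edom f u by rewrite /edom /= (lt_trans uc)// ltry.
have [s fs] := proper_real pf fu; move: uc; rewrite fs lte_fin => sc.
pose v := x - u; have xv : x - v = u by rewrite /v opprB addrC subrK.
(* With this [N], a pairing of at least [- N] yields [f (y - t *: v) <= c], hence [|t| >= d]. Then
   [t * pairing v ys >= N * d] outweighs the error [N * d / 2], and the pairing at [y - t *: v] is
   positive. *)
pose N := (c - s) / 2.
have N0 : 0 < N by rewrite /N; lra.
have [W xW Wf] := lf _ _ cx.
have [A [xA tA AW]] : exists A : set X * set R, [/\ nbhs x A.1, nbhs (0 : R) A.2 &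
    forall y' t', A.1 y' -> A.2 t' -> W (y' - t' *: v)].
  by apply: near_sub_scale; rewrite scale0r subr0.
move: tA => /nbhs_ballP[d /= d0 dA].
have Gg := Gamma_segment_conv v Gf (ltW N0).
have gxs : (segment_conv f v N x <= (s + N)%:E)%E.
  apply: (@le_trans _ _ (segment_term f v N x 1)).
    by apply: segment_conv_le; rewrite normr1.
  by rewrite /segment_term scale1r xv fs normr1 mulr1 EFinD.
have gx : edom (segment_conv f v N) x by rewrite /edom /= (le_lt_trans gxs)// ltry.
have e0 : 0 < Num.min N (N * d / 2) by rewrite lt_min N0/= divr_gt0// mulr_gt0.
have [[y ys] /= [sy Ay ey]] := approx_near approx Gg gx xA e0.
have {ey} [ey1 ey2] : - N <= pairing (x - y) ys /\ - (N * d / 2) <= pairing (x - y) ys.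
  by split; apply: le_trans ey; rewrite lerN2 ge_min lexx ?orbT.
have [q gq le_q] := subdiff_real sy; have := le_q _ _ gxs.
have [t [t1 gt sz Nt _]] := subdiff_segment_conv Gf (ltW N0) sy.
rewrite /= in gq gt sz Nt *.
have [z fz _] := subdiff_real sz.
have qE : q = z + N * `|t| by apply: EFin_inj; rewrite -gq gt /segment_term fz.
have Nt0 : 0 <= N * `|t| by rewrite mulr_ge0// ltW.
have [td|td] := ltP `|t| d.
  have : (c%:E < f (y - t *: v)%R)%E.
    by apply/Wf/AW => //; apply: dA; rewrite /ball /= sub0r normrN.
  by rewrite fz lte_fin; rewrite /N in ey1 Nt0 qE *; lra.
have := neg (y - t *: v, ys) sz; rewrite /= !pairingB pairingZ => neg_z _.
have : N * d <= N * `|t| by rewrite ler_wpM2l// ltW.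
have := mulr_gt0 N0 d0; move: ey2; rewrite !pairingB; lra.
Qed.

Theorem approx_maximal f : Gamma f -> maximal_monotone (subdiff f).
Proof.
move=> Gf; have [pf _ _] := Gf; split.
- have [[u fu] _] := pf; have [a sa _] := approx Gf fu ltr01.
  by exists a.
- exact: subdiff_monotone.
move=> S monS sub; apply/seteqP; split => // -[x xs] Sx.
(* Tilting [f] by [- xs] moves the pair [(x, xs)] to [(x, 0)]. *)
have min_x : forall u, (f x + (pairing x (- xs))%:E <= f u + (pairing u (- xs))%:E)%E.
  apply: (approx_minimum (Gamma_add_linear (- xs) Gf)) => -[a as_] sa.
  have /sub Sa : Graph (subdiff f) (a, as_ - - xs).
    apply: (subdiff_add_linear pf _ sa) => y; by rewrite pairingB.
  have : 0 <= pairing (x - a) (xs - (as_ - - xs)) by exact: monS Sx Sa.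
  by rewrite !pairingBr pairingNr /=; lra.
have [[u fu] _] := pf; have [s fs] := proper_real pf fu.
have fx : edom f x.
  have := min_x u; rewrite fs /edom /= -EFinD.
  by case: (f x) => [r|//|//]; rewrite ltry.
have [r fr] := proper_real pf fx.
apply: (subdiff_of_real pf fr) => y q fq.
have := min_x y; rewrite fr fq -!EFinD lee_fin !pairingNr pairingB; lra.
Qed.

End consequences.

(** * Closures of the domain and of the range *)

Section closures.
Context (R : realType) (X : tvsType R).
Implicit Types (f : X -> \bar R) (x y : X) (xs ys : dual X).

Lemma convex_setP (M : lmodType R) (A : set M) :
  (forall u v t, 0 < t < 1 -> A u -> A v -> A (t *: u + (1 - t) *: v)) -> convex_set A.
Proof.
move=> convA; apply/convex_setW => u v; rewrite !inE => Au Av k k0 k1.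
by rewrite inE; apply: convA => //; rewrite k0.
Qed.

Lemma convex_closure (A : set X) :
  (forall x y t, 0 < t < 1 -> A x -> A y -> A (t *: x + (1 - t) *: y)) ->
  convex_set (closure A).
Proof.
move=> convA; apply: convex_setP => x y t t01 clx cly B.
move=> /(@add_continuous X (t *: x, (1 - t) *: y) B)[[B1 B2] /= [xB yB] BB].
have [[C1 C2] /= [tC xC] CB] := @scale_continuous R X (t, x) B1 xB.
have [[D1 D2] /= [tD yD] DB] := @scale_continuous R X (1 - t, y) B2 yB.
have [x' [Ax' Cx']] := clx _ xC.
have [y' [Ay' Dy']] := cly _ yD.
exists (t *: x' + (1 - t) *: y'); split; first exact: convA.
apply: (BB (t *: x', (1 - t) *: y')); split.
  by apply: (CB (t, x')); split => //; exact: nbhs_singleton.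
by apply: (DB (1 - t, y')); split => //; exact: nbhs_singleton.
Qed.

Lemma pairing_continuous x : continuous (fun ys : dual X => pairing x ys).
Proof.
move=> xs.
have h : @dual_fun R X @ xs --> (dual_fun xs : {ptws X -> R^o}).
  exact: (@initial_continuous (dual X) {ptws X -> R^o} (@dual_fun R X) xs).
have FF : Filter (@dual_fun R X @ xs) by apply: fmap_filter; exact: nbhs_filter.
exact: ((@pointwise_cvgP X R^o (@dual_fun R X @ xs) (dual_fun xs) FF).1 h x).
Qed.

(** Finitely many test vectors and one tolerance describe the weak-star neighbourhoods. Conversely,
    the approximants generate a filter on [A] that converges pointwise to [xs]. *)
Lemma dual_closureP (A : set (dual X)) xs : closure A xs <->
  forall (s : seq X) (e : R), 0 < e ->
    exists2 ys, A ys & forall x, x \in s -> `|pairing x ys - pairing x xs| < e.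
Proof.
split=> [clA s e e0|approxA].
  have : \forall ys \near xs, forall x, x \in s -> `|pairing x ys - pairing x xs| < e.
    elim: s => [|x s IH]; first by near=> ys.
    have /cvgrPdist_lt/(_ e e0) hx := @pairing_continuous x xs.
    near=> ys => z; rewrite inE => /predU1P[->|zs].
      by rewrite distrC; near: ys.
    by move: z zs; near: ys.
  by move=> /clA[ys [Ays h]]; exists ys.
pose G := filter_from [set p : seq X * R | 0 < p.2] (fun p => [set ys | A ys /\
  forall x, x \in p.1 -> `|pairing x ys - pairing x xs| < p.2]).
have FG : ProperFilter G.
  apply: filter_from_proper; last first.
    by move=> [s e] /= /(approxA s)[ys Ays h]; exists ys.
  apply: filter_from_filter; first by exists ([::], 1) => /=.
  move=> [s e] [s' e'] /= e0 e'0; exists (s ++ s', Num.min e e').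
    by rewrite /= lt_min e0.
  move=> ys /= [Ays h]; split; split => //; move=> x xs'.
    have : x \in s ++ s' by rewrite mem_cat xs'.
    by move=> /h; rewrite lt_min => /andP[].
  have : x \in s ++ s' by rewrite mem_cat xs' orbT.
  by move=> /h; rewrite lt_min => /andP[].
rewrite closureEcvg; exists G => //; split; last first.
  by move=> B AB; exists ([::], 1) => //= ys [Ays _]; exact: AB.
have ptw : @dual_fun R X @ G --> (dual_fun xs : {ptws X -> R^o}).
  apply/(@pointwise_cvgP X R^o (@dual_fun R X @ G) (dual_fun xs) _) => x.
  apply/cvgrPdist_lt => e e0.
  exists ([:: x], e) => //= ys [_ /(_ x)]; rewrite inE eqxx => /(_ isT).
  by rewrite distrC.
move=> B; rewrite nbhsE => -[W [[U oU <-] Uxs] WB].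
have : nbhs (dual_fun xs : {ptws X -> R^o}) U by exact: open_nbhs_nbhs.
by move=> /ptw GU; apply: (filterS WB); exact: GU.
Unshelve. all: by end_near. Qed.

Lemma convex_dual_closure (A : set (dual X)) :
  (forall xs ys t, 0 < t < 1 -> A xs -> A ys -> A (t *: xs + (1 - t) *: ys)) ->
  convex_set (closure A).
Proof.
move=> convA; apply: convex_setP => xs ys t t01 /dual_closureP clx /dual_closureP cly.
have [t0 t1] := andP t01.
apply/dual_closureP => s e e0.
have [xs' Axs' hx] := clx s e e0; have [ys' Ays' hy] := cly s e e0.
exists (t *: xs' + (1 - t) *: ys'); first exact: convA.
move=> x xin; rewrite !pairingDr !pairingZr.
have := hx x xin; have := hy x xin; rewrite !ltr_norml => /andP[? ?] /andP[? ?].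
by apply/andP; split; nra.
Qed.

Lemma edom_conjugateP f xs : Defs.proper f ->
  edom (conjugate f) xs <-> exists K, forall y r, f y = r%:E -> pairing y xs - r <= K.
Proof.
move=> pf; split=> [domxs|[K le_K]]; last first.
  rewrite /edom /=; apply: (@le_lt_trans _ _ K%:E); last exact: ltry.
  apply: ge_ereal_sup => _ [y _ <-].
  have := pf.2 y; case fy : (f y) => [r||]// _; last by rewrite addeNy leNye.
  by rewrite -EFinB lee_fin; exact: le_K.
have conj_ge y r : f y = r%:E -> ((pairing y xs - r)%:E <= conjugate f xs)%E.
  by move=> fy; apply: ereal_sup_ubound; exists y => //; rewrite fy EFinB.
exists (fine (conjugate f xs)) => y r /[dup] fy /conj_ge h.
rewrite -lee_fin fineK// fin_numE -ltey -ltNye domxs andbT.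
by apply: lt_le_trans h; exact: ltNyr.
Qed.

Lemma edom_convex f x y t : Gamma f -> 0 < t < 1 ->
  edom f x -> edom f y -> edom f (t *: x + (1 - t) *: y).
Proof.
move=> [pf cf _] t01 fx fy.
have [r fr] := proper_real pf fx; have [s fs] := proper_real pf fy.
have := (econvexP pf).1 cf x y r s t t01.
by rewrite fr fs => /(_ (lexx _) (lexx _)) h; rewrite /edom /= (le_lt_trans h)// ltry.
Qed.

Lemma edom_conjugate_convex f xs ys t : Gamma f -> 0 < t < 1 ->
  edom (conjugate f) xs -> edom (conjugate f) ys ->
  edom (conjugate f) (t *: xs + (1 - t) *: ys).
Proof.
move=> [pf _ _] /andP[t0 t1] /(edom_conjugateP _ pf)[K hK] /(edom_conjugateP _ pf)[L hL].
apply/(edom_conjugateP _ pf); exists (t * K + (1 - t) * L) => y r fy.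
by rewrite pairingDr !pairingZr; have := hK _ _ fy; have := hL _ _ fy; nra.
Qed.

Lemma Dom_sub_edom f : Dom (subdiff f) `<=` edom f.
Proof. by move=> _ [a /subdiff_real[r fa _] <-]; rewrite /edom /= fa ltry. Qed.

Lemma Ran_sub_edom_conjugate f : Defs.proper f ->
  Ran (subdiff f) `<=` edom (conjugate f).
Proof.
move=> pf _ [[a as_] /subdiff_real[r fa le_r] <-]; apply/(edom_conjugateP _ pf).
exists (pairing a as_ - r) => y s fy; have := le_r y s; rewrite fy => /(_ (lexx _)).
by rewrite pairingB /=; lra.
Qed.

Hypothesis approx : approximable X.

(** Induction on [s], for all [f] at once: the hypothesis is applied to the convolution along [v]
    with [N = 0]. Passing from [y] to [y - t *: v] adds [t * pairing v ys], which is nonnegative and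
    at least [|pairing v ys|], so earlier bounds survive. *)
Lemma approx_bounded_on (s : seq X) f x (e : R) : Gamma f -> edom f x -> 0 < e ->
  exists a : X * dual X, [/\ Graph (subdiff f) a, - e <= pairing (x - a.1) a.2 &
    forall v, v \in s -> `|pairing v a.2| <= pairing (x - a.1) a.2 + e].
Proof.
elim: s f => [|v s IH] f Gf fx e0.
  by have [a fa ea] := approx Gf fx e0; exists a.
have N0 : 0 <= (0 : R) by [].
have Gg := Gamma_segment_conv v Gf N0.
have gx : edom (segment_conv f v 0) x.
  rewrite /edom /=; apply: le_lt_trans fx.
  have := @segment_conv_le R X f v 0 x 0.
  by rewrite normr0 ler01 /segment_term scale0r subr0 mul0r adde0; exact.
have [[y ys] /= [sy ey sv]] := IH _ Gg gx e0.
have [t [t1 _ sz Nt vt]] := subdiff_segment_conv Gf N0 sy.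
exists (y - t *: v, ys); split => //=.
  by move: ey Nt; rewrite /= !pairingB pairingZ; lra.
move=> w; rewrite inE => /predU1P[->|ws].
  by move: ey Nt vt; rewrite /= !pairingB pairingZ; lra.
by have := sv w ws; move: ey Nt vt; rewrite /= !pairingB pairingZ; lra.
Qed.

Lemma approx_closure_Dom f : Gamma f -> closure (Dom (subdiff f)) = closure (edom f).
Proof.
move=> Gf; apply/seteqP; split; first exact/closure_subset/Dom_sub_edom.
rewrite [X in _ `<=` X](closure_id _).1; last exact: closed_closure.
apply: closure_subset => x fx B Bx.
have [[a as_] /= [sa Ba _]] := approx_near approx Gf fx Bx ltr01.
by exists a; split => //; exists (a, as_).
Qed.

Lemma approx_closure_Ran f : Gamma f ->
  closure (Ran (subdiff f)) = closure (edom (conjugate f)).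
Proof.
move=> Gf; have [pf _ _] := Gf.
apply/seteqP; split; first exact/closure_subset/Ran_sub_edom_conjugate.
rewrite [X in _ `<=` X](closure_id _).1; last exact: closed_closure.
apply: closure_subset => xs /(edom_conjugateP _ pf)[K hK].
apply/dual_closureP => s e e0.
have [[x fx] _] := pf; have [r fr] := proper_real pf fx.
pose g y := (f y + (pairing y (- xs))%:E)%E.
have gx : edom g x by rewrite /edom /= /g fr -EFinD ltry.
(* [C] bounds the pairing at [a] plus 1, because the tilted function [g] is at least [- K]. Scaling
   the test vectors by [N] brings this down to [C / N = e / 2]. *)
pose C := 1 + (r - pairing x xs + K); pose N := 2 * C / e.
have C0 : 0 < C by have := hK _ _ fr; rewrite /C; lra.
have N0 : 0 < N by rewrite divr_gt0// mulr_gt0.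
have [[a as_] /= [sa _ va]] :=
  approx_bounded_on [seq N *: v | v <- s] (Gamma_add_linear (- xs) Gf) gx ltr01.
have sfa : subdiff f a (as_ - - xs).
  by apply: (subdiff_add_linear pf _ sa) => y; rewrite pairingB.
have [q fq le_q] := subdiff_real sfa.
exists (as_ - - xs); first by exists (a, as_ - - xs).
move=> v vs; rewrite pairingBr pairingNr opprK addrK.
have := va (N *: v) (map_f _ vs); rewrite pairingZ normrM (gtr0_norm N0).
have := le_q x r; rewrite fr => /(_ (lexx _)).
rewrite pairingBr pairingNr opprK => le_xr Nv.
have := hK _ _ fq => qK.
have : N * `|pairing v as_| <= C.
  by move: Nv le_xr; rewrite /C !pairingB; lra.
rewrite -ler_pdivlMl// => /le_lt_trans; apply.
have -> : N^-1 * C = e / 2 by rewrite /N; field; rewrite !gt_eqF.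
lra.
Qed.

End closures.

(** * Nets *)

Section nets.
Context (R : realType).

Lemma cvg_ereal_netP (I : directed_set) (u : I -> \bar R) (r : R) :
  u @ tails I --> r%:E <-> forall d, 0 < d -> exists i0, forall i, directed_le i0 i ->
    exists2 s : R, u i = s%:E & `|s - r| < d.
Proof.
split=> [ucvg d d0|unear B].
  have : nbhs r%:E [set z : \bar R | exists2 s : R, z = s%:E & `|s - r| < d].
    apply/nbhs_EFin/nbhs_ballP; exists d => //= s; rewrite /ball /= distrC.
    by exists s.
  by move=> /ucvg[i0 h]; exists i0 => i /h.
move=> /nbhs_EFin /nbhs_ballP[d /= d0 dB]; have [i0 h] := unear d d0.
exists i0 => i /h[s us sr]; rewrite /= us; apply: dB.
by rewrite /ball /= distrC.
Qed.

Context (X : tvsType R).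

(** Indices of the net for (v): a neighbourhood paired with a positive error, both shrinking along
    the order. *)
Definition tolerance (x : X) := {p : set X * R | nbhs x p.1 /\ 0 < p.2}.

Definition Tolerance x V e (xV : nbhs x V) (e0 : 0 < e) : tolerance x :=
  exist _ (V, e) (conj xV e0).

Definition tolerance_le x (p q : tolerance x) :=
  (sval q).1 `<=` (sval p).1 /\ (sval q).2 <= (sval p).2.

Lemma tolerance_inhabited x : exists i : tolerance x, True.
Proof. by exists (Tolerance (filterT : nbhs x setT) ltr01). Qed.

Lemma tolerance_refl x (i : tolerance x) : tolerance_le i i.
Proof. by split. Qed.

Lemma tolerance_trans x (i j k : tolerance x) :
  tolerance_le i j -> tolerance_le j k -> tolerance_le i k.
Proof.
by move=> [ji ij] [kj jk]; split; [exact: subset_trans ji|exact: le_trans ij].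
Qed.

Lemma tolerance_ub x (i j : tolerance x) :
  exists2 k, tolerance_le i k & tolerance_le j k.
Proof.
case: i j => [[V e] [/= xV e0]] [[W d] [/= xW d0]].
have ed0 : 0 < Num.min e d by rewrite lt_min e0.
by exists (Tolerance (filterI xV xW) ed0); split=> /=; rewrite ?ge_min ?lexx ?orbT//.
Qed.

Definition nbhs_tolerance x := DirectedSet (tolerance_inhabited x)
  (@tolerance_refl x) (@tolerance_trans x) (@tolerance_ub x).

Lemma approx_net (f : X -> \bar R) x : approximable X -> Gamma f -> edom f x ->
  exists (I : directed_set) (a : I -> X * dual X),
    [/\ forall i, Graph (subdiff f) (a i),
        (a i).1 @[i --> tails I] --> x,
        f (a i).1 @[i --> tails I] --> f x &
        ((pairing (x - (a i).1)%R (a i).2)%:E + f (a i).1)%E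
          @[i --> tails I] --> f x].
Proof.
move=> approx Gf fx; have [pf _ _] := Gf; have [r fr] := proper_real pf fx.
have /choice[a aP] (i : nbhs_tolerance x) : exists a : X * dual X,
    [/\ Graph (subdiff f) a, (sval i).1 a.1, (f a.1 <= f x)%E,
     (f x - (sval i).2%:E <= f a.1)%E & - (sval i).2 <= pairing (x - a.1) a.2].
  by case: i => -[V e] /= [xV e0]; exact: approx_near_below.
have tol d : 0 < d -> exists i0 : nbhs_tolerance x, forall i, directed_le i0 i -> (sval i).2 < d.
  move=> d0; have d20 : 0 < d / 2 by rewrite divr_gt0.
  by exists (Tolerance (filterT : nbhs x setT) d20) => i [_] /= /le_lt_trans; apply; lra.
exists (nbhs_tolerance x), a; split.
- by move=> i; have [] := aP i.
- move=> V xV; exists (Tolerance xV ltr01) => i [iV _].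
  by have [_ ? _ _ _] := aP i; exact: iV.
- rewrite fr; apply/cvg_ereal_netP => d /tol[i0 i0d]; exists i0 => i /i0d id.
  have [sa _ le1 le2 _] := aP i; have [s fs _] := subdiff_real sa.
  exists s => //; move: le1 le2; rewrite fs fr -EFinB !lee_fin ltr_norml => *.
  by apply/andP; split; lra.
(* The subgradient inequality bounds the sum by [f x] from above; below, the value and the pairing
   each lose at most the tolerance, hence [d / 2]. *)
- rewrite fr; apply/cvg_ereal_netP => d d0.
  have [|i0 i0d] := tol (d / 2); first by rewrite divr_gt0.
  exists i0 => i /i0d id.
  have [sa _ _ le2 le3] := aP i; have [s fs le_s] := subdiff_real sa.
  have := le_s x r; rewrite fr => /(_ (lexx _)) le_r.
  exists (pairing (x - (a i).1) (a i).2 + s); first by rewrite fs.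
  move: le2; rewrite fs fr -EFinB !lee_fin ltr_norml => *.
  by apply/andP; split; lra.
Qed.

End nets.

(** * Conditions that imply (vii) *)

Section approximability.
Context (R : realType) (X : tvsType R).

(** If the inequality failed, [(x, xs)] would be monotonically related to the graph and so belong to
    it by maximality; but its own term in the supremum equals [pairing x xs]. *)
Lemma maximal_monotone_fitzpatrick (T : X -> set (dual X)) x xs :
  maximal_monotone T -> ((pairing x xs)%:E <= fitzpatrick T x xs)%E.
Proof.
move=> [_ mon max]; rewrite leNgt; apply/negP => lt_x.
have lt_a a : Graph T a -> pairing (x - a.1) a.2 + pairing a.1 xs < pairing x xs.
  move=> Ta; rewrite -lte_fin; apply: le_lt_trans lt_x.
  by apply: ereal_sup_ubound; exists a.
have rel a : Graph T a -> 0 <= pairing (x - a.1) (xs - a.2).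
  by move=> /lt_a; rewrite pairingBr !pairingB; lra.
pose S y : set (dual X) := T y `|` [set ys | y = x /\ ys = xs].
have monS p q : Graph S p -> Graph S q -> 0 <= pairing (p.1 - q.1) (p.2 - q.2).
  move=> [Tp|[p1 p2]] [Tq|[q1 q2]].
  - exact: mon.
  - by rewrite q1 q2; have := rel _ Tp; rewrite !pairingBr !pairingB; lra.
  - by rewrite p1 p2; exact: rel.
  - by rewrite p1 p2 q1 q2 subrr pairing0.
have SE : Graph S = Graph T by apply: max => // a Ta; left.
have : Graph T (x, xs) by rewrite -SE; right.
by move=> /lt_a /=; rewrite subrr pairing0 add0r ltxx.
Qed.

Lemma fitzpatrick_approximable :
  (forall f : X -> \bar R, Gamma f -> forall x, edom f x ->
    forall xs, ((pairing x xs)%:E <= fitzpatrick (subdiff f) x xs)%E) ->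
  approximable X.
Proof.
move=> fitz f Gf x fx e e0.
have : ((- e)%:E < fitzpatrick (subdiff f) x (0 : dual X)%R)%E.
  by apply: lt_le_trans (fitz f Gf x fx 0); rewrite lte_fin oppr_lt0.
move=> /ereal_sup_gt[_ [a sa <-]]; rewrite lte_fin => /ltW h.
by exists a => //; move: h; rewrite -[pairing a.1 0]/(0 : R) addr0.
Qed.

(** A term above [f x - e] whose value part is at most [f x] has pairing part above [- e]. *)
Lemma low_upper_approximable :
  (forall f : X -> \bar R, Gamma f -> forall x, edom f x -> f x = low_upper f x) ->
  approximable X.
Proof.
move=> low f Gf x fx e e0; have [pf _ _] := Gf; have [r fr] := proper_real pf fx.
have : ((r - e)%:E < low_upper f x)%E by rewrite -low// fr lte_fin; lra.
move=> /ereal_sup_gt[_ [a [sa ax] <-]]; have [s fs _] := subdiff_real sa.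
move: ax; rewrite /= fs fr -EFinD lte_fin lee_fin => sr lt_r.
by exists a => //; lra.
Qed.

End approximability.

Theorem theorem16 (R : realType) (X : tvsType R)
    (X_hausdorff : hausdorff_space X) (X_nontrivial : exists x : X, x != 0) :
  [<->
    (* (i) *)
    forall f : X -> \bar R, Gamma f -> maximal_monotone (subdiff f);
    (* (ii) *)
    forall f : X -> \bar R, Gamma f -> forall x, edom f x ->
      forall xs : dual X,
        ((pairing x xs)%:E <= fitzpatrick (subdiff f) x xs)%E;
    (* (iii) *)
    forall f : X -> \bar R, Gamma f -> forall x, edom f x ->
      f x = low_upper f x;
    (* (iv) *)
    forall f : X -> \bar R, Gamma f -> f = low_upper f;
    (* (v) *)
    forall f : X -> \bar R, Gamma f -> forall x, edom f x ->
      exists (I : directed_set) (a : I -> X * dual X),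
        [/\ forall i, Graph (subdiff f) (a i),
            (a i).1 @[i --> tails I] --> x,
            f (a i).1 @[i --> tails I] --> f x &
            ((pairing (x - (a i).1)%R (a i).2)%:E + f (a i).1)%E
              @[i --> tails I] --> f x];
    (* (vi) *)
    forall f : X -> \bar R, Gamma f -> forall x, edom f x ->
      exists (I : directed_set) (a : I -> X * dual X),
        (forall i, Graph (subdiff f) (a i)) /\
        pairing (x - (a i).1) (a i).2 @[i --> tails I] --> (0 : R);
    (* (vii) *)
    forall f : X -> \bar R, Gamma f -> forall x, edom f x ->
      forall e : R, 0 < e ->
        exists2 a : X * dual X, Graph (subdiff f) a &
          - e <= pairing (x - a.1) a.2]
  /\
  ((forall f : X -> \bar R, Gamma f -> maximal_monotone (subdiff f)) ->
   forall f : X -> \bar R, Gamma f ->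
     [/\ closure (Dom (subdiff f)) = closure (edom f),
         closure (Ran (subdiff f)) = closure (edom (conjugate f)),
         convex_set (closure (edom f)) &
         convex_set (closure (edom (conjugate f)))]).
Proof.
split; last first.
  move=> maxi; have approx : approximable X.
    apply: fitzpatrick_approximable => f Gf x _ xs.
    exact: (maximal_monotone_fitzpatrick x xs (maxi f Gf)).
  move=> f Gf; split.
  - exact: approx_closure_Dom.
  - exact: approx_closure_Ran.
  - by apply: convex_closure => x y t; exact: edom_convex.
  - by apply: convex_dual_closure => xs ys t; exact: edom_conjugate_convex.
(* The implications form a cycle; those leading to (iii), (iv) and (v) first recover (vii). *)
tfae.
- by move=> maxi f Gf x _ xs; exact: (maximal_monotone_fitzpatrick x xs (maxi f Gf)).
- move=> /fitzpatrick_approximable approx f Gf x fx.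
  exact: approx_low_upper_dom.
- by move=> /low_upper_approximable approx f Gf; exact: approx_low_upper.
- move=> low f Gf x fx; apply: approx_net => //.
  by apply: low_upper_approximable => g Gg y _; rewrite -low.
- move=> net f Gf x fx; have [I [a [sa _ fa pa]]] := net f Gf x fx.
  exists I, a; split => //; have [pf _ _] := Gf; have [r fr] := proper_real pf fx.
  rewrite fr in fa pa; apply/cvgrPdist_lt => e e0; have e20 : 0 < e / 2 by lra.
  have [i hi] := (cvg_ereal_netP _ _).1 fa _ e20.
  have [j hj] := (cvg_ereal_netP _ _).1 pa _ e20.
  have [k ik jk] := directed_ub i j.
  exists k => l kl; have [s fs sr] := hi l (directed_trans ik kl).
  have [q qE qr] := hj l (directed_trans jk kl).
  have {}qE : pairing (x - (a l).1) (a l).2 + s = q.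
    by apply: EFin_inj; rewrite -qE fs EFinD.
  rewrite sub0r normrN; move: sr qr; rewrite -qE !ltr_norml => /andP[? ?] /andP[? ?].
  by apply/andP; split; lra.
- move=> net f Gf x fx e e0; have [I [a [sa /cvgrPdist_lt/(_ e e0)]]] := net f Gf x fx.
  case=> i /(_ i (directed_refl i)); rewrite sub0r normrN ltr_norml => /andP[h _].
  by exists (a i) => //; exact: ltW.
- by move=> approx f Gf; exact: approx_maximal.
Qed.
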